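(* Let $W$ be a real JBW$^*$-triple, and let $M$ and $N$ be two non-zero $M$-summands of $W$ with $W=M\oplus^{\ell_\infty}N$; let $P$ denote the natural projection of $W$ onto $M$. Then for each complete tripotent $e$ in $W$ (equivalently, each extreme point of the closed unit ball of $W$), the elements $P(e)$ and $(Id-P)(e)$ are two orthogonal non-zero tripotents in $W$. Moreover, $P(e)$ is an extreme point of the closed unit ball $\mathcal{B}_M$ of $M$ and $(Id-P)(e)$ is an extreme point of the closed unit ball $\mathcal{B}_N$ of $N$.
   Context: A real JB$^*$-triple is a norm-closed real subspace of a complex JB$^*$-triple closed under the triple product $\{\cdot,\cdot,\cdot\}$; a real JBW$^*$-triple is one which is a dual Banach space. An element $e$ is a tripotent if $\{e,e,e\}=e$; the Peirce-$0$ space is $W_0(e)=\{x:\{e,e,x\}=0\}$, and $e$ is complete if $W_0(e)=\{0\}$. Elements $x,y$ are orthogonal if the operator $L(x,y)=\{x,y,\cdot\}$ is zero. $W=M\oplus^{\ell_\infty}N$ means $W=M\oplus N$ algebraically with $\|m+n\|=\max\{\|m\|,\|n\|\}$; such $M,N$ are called $M$-summands. *)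

(* Defs.v *)
(* MathComp + MathComp-Analysis; complex scalars are R[i] = complex R
   (mathcomp-real-closed) over R : realType. *)
From HB Require Import structures.
From mathcomp Require Import all_boot all_order all_algebra.
From mathcomp Require Import all_classical all_reals all_analysis.
From mathcomp Require Import complex.
Set Implicit Arguments. Unset Strict Implicit. Unset Printing Implicit Defensive.
Import Order.TTheory GRing.Theory Num.Theory numFieldNormedType.Exports.
Local Open Scope ring_scope.
Local Open Scope complex_scope.
Local Open Scope classical_set_scope.

Section JB.
Variable R : realType.
Variable E : normedModType R[i].

(* ---------- Banach space / operators on the complex space E ---------- *)

(* E is complete (every Cauchy sequence converges). *)
Definition complete_space : Prop :=
  forall u : nat -> E,
    (forall eps : R, 0 < eps -> exists N : nat, forall m n : nat,
        (N <= m)%N -> (N <= n)%N -> `|u m - u n| < eps%:C) ->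
    exists l : E, forall eps : R, 0 < eps -> exists N : nat, forall n : nat,
        (N <= n)%N -> `|u n - l| < eps%:C.

(* complex-linear maps *)
Definition clinear (T : E -> E) : Prop :=
  forall (a : R[i]) (x y : E), T (a *: x + y) = a *: T x + T y.

Definition clinear_functional (f : E -> R[i]) : Prop :=
  forall (a : R[i]) (x y : E), f (a *: x + y) = a * f x + f y.

(* bounded (= continuous) linear operators on E *)
Definition bounded_operator (T : E -> E) : Prop := clinear T /\ continuous T.

(* T is invertible in the Banach algebra B(E) *)
Definition invertible_operator (T : E -> E) : Prop :=
  exists S : E -> E, bounded_operator S /\
    (forall x, S (T x) = x) /\ (forall x, T (S x) = x).

(* lambda belongs to the spectrum of T in B(E) *)
Definition in_spectrum (T : E -> E) (lambda : R[i]) : Prop :=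
  ~ invertible_operator (fun x => T x - lambda *: x).

(* Hermitian operator (Lumer--Vidav): its (spatial) numerical range
   { f (T x) : |x| = 1, |f| <= 1, f x = 1 } is real. *)
Definition hermitian_op (T : E -> E) : Prop :=
  forall (x : E) (f : E -> R[i]),
    `|x| = 1 -> clinear_functional f -> (forall y, `|f y| <= `|y|) ->
    f x = 1 -> complex.Im (f (T x)) = 0.

Definition nonneg_spectrum (T : E -> E) : Prop :=
  forall lambda, in_spectrum T lambda ->
    complex.Im lambda = 0 /\ 0 <= complex.Re lambda.

(* ---------- complex JB*-triples ---------- *)

Definition is_JBstar_triple (tp : E -> E -> E -> E) : Prop :=
  [/\ complete_space,
      ((* bilinear symmetric in the outer variables, conjugate linear in the middle *)
      (forall (a : R[i]) x x' y z, tp (a *: x + x') y z = a *: tp x y z + tp x' y z) /\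
      (forall x y z, tp x y z = tp z y x) /\
      (forall (a : R[i]) x y y' z, tp x (a *: y + y') z = (a^*)%R *: tp x y z + tp x y' z)),
      (* continuity *)
      continuous (fun p : E * E * E => tp p.1.1 p.1.2 p.2),
      (* Jordan identity *)
      (forall a b x y z,
         tp a b (tp x y z) = tp (tp a b x) y z - tp x (tp b a y) z + tp x y (tp a b z)) /\
      (* L(a,a) is hermitian with non-negative spectrum *)
      (forall a, hermitian_op (tp a a) /\ nonneg_spectrum (tp a a)) &
      (* the C*-identity for triples *)
      (forall x, `|tp x x x| = `|x| ^+ 3)].

(* ---------- real subspaces, real JB*-triples, real JBW*-triples ---------- *)

Definition real_subspace (W : set E) : Prop :=
  [/\ W 0, (forall x y, W x -> W y -> W (x + y)) &
      (forall (r : R) x, W x -> W (r%:C *: x))].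

(* W is a real JB*-triple: a norm-closed real subspace of the complex
   JB*-triple (E, tp) closed under the triple product. *)
Definition is_real_JBstar_triple (tp : E -> E -> E -> E) (W : set E) : Prop :=
  [/\ is_JBstar_triple tp, real_subspace W, closed W &
      (forall x y z, W x -> W y -> W z -> W (tp x y z))].

(* W (with the norm of E) is a dual Banach space over R: there is a real
   normed space Y and a real-linear isometric bijection Phi from W onto the
   space of continuous real-linear functionals on Y (with the dual norm). *)
Definition is_real_dual_space (W : set E) : Prop :=
  exists (Y : normedModType R) (Phi : E -> Y -> R),
  [/\ (forall w, W w -> forall (a : R) (y y' : Y),
          Phi w (a *: y + y') = a * Phi w y + Phi w y'),
      (forall (r : R) w w', W w -> W w' ->
          Phi (r%:C *: w + w') = (fun y => r * Phi w y + Phi w' y)),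
      (forall w, W w ->
          (forall y : Y, (`|Phi w y|)%:C <= `|w| * (`|y|)%:C) /\
          (forall eps : R, 0 < eps ->
             exists y : Y, `|y| <= 1 /\ `|w| - eps%:C < (`|Phi w y|)%:C)) &
      (forall g : Y -> R,
          (forall (a : R) (y y' : Y), g (a *: y + y') = a * g y + g y') ->
          continuous g -> exists w, W w /\ Phi w = g)].

Definition is_real_JBWstar_triple (tp : E -> E -> E -> E) (W : set E) : Prop :=
  is_real_JBstar_triple tp W /\ is_real_dual_space W.

(* ---------- tripotents, Peirce-0 space, orthogonality ---------- *)

Definition tripotent (tp : E -> E -> E -> E) (W : set E) (e : E) : Prop :=
  W e /\ tp e e e = e.

(* e is complete: the Peirce-0 space W_0(e) = {x in W : {e,e,x} = 0} is {0} *)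
Definition complete_tripotent (tp : E -> E -> E -> E) (W : set E) (e : E) : Prop :=
  tripotent tp W e /\ (forall x, W x -> tp e e x = 0 -> x = 0).

(* x and y are triple_orthogonal: the operator L(x,y) = {x,y,.} on W is zero *)
Definition triple_orthogonal (tp : E -> E -> E -> E) (W : set E) (x y : E) : Prop :=
  forall z, W z -> tp x y z = 0.

(* ---------- M-summands and extreme points ---------- *)

(* W = M (+)^{l_oo} N *)
Definition linf_decomposition (W M N : set E) : Prop :=
  [/\ real_subspace M /\ real_subspace N, M `<=` W /\ N `<=` W,
      (forall w, W w -> exists m n, [/\ M m, N n & w = m + n]),
      (forall m n, M m -> N n -> m + n = 0 -> m = 0 /\ n = 0) &
      (forall m n, M m -> N n -> `|m + n| = Num.max `|m| `|n|)].

(* x is an extreme point of the closed unit ball of the (real) subspace M *)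
Definition extreme_point_ball (M : set E) (x : E) : Prop :=
  [/\ M x, `|x| <= 1 &
      forall (y z : E) (t : R), M y -> M z -> `|y| <= 1 -> `|z| <= 1 ->
        0 < t < 1 -> x = t%:C *: y + (1 - t)%:C *: z -> y = z].

End JB.

(* Main.v *)
Require Import Defs.
From HB Require Import structures.
From mathcomp Require Import all_boot all_order all_algebra.
From mathcomp Require Import all_classical all_reals all_analysis.
From mathcomp Require Import complex ring lra zify.
Import Order.TTheory GRing.Theory Num.Theory numFieldNormedType.Exports.
Set Implicit Arguments. Unset Strict Implicit. Unset Printing Implicit Defensive.
Local Open Scope ring_scope.
Local Open Scope complex_scope.
Local Open Scope classical_set_scope.

(* Let e = m + n be the decomposition of the complete tripotent. Everything is
   read off from the first-order behaviour of the norm at e.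

   The operators L(a,b) - L(b,a), and i L(a,e) for a in the self-adjoint part A
   of the Peirce space E_2(e), generate isometries; in particular e + tT(Te) stays
   in the unit ball to first order in t > 0 when T is such a generator, so squares
   are positive. The identity |{x,x,x}| = |x|^3 shows that the norm at e is flat
   in the directions transversal to A. In a direction p of A it is flat only for
   p = 0: otherwise |(e + tp)^(3^k)| = |e + tp|^(3^k) would stay bounded for
   t 3^k of order one, whereas its odd part has norm at least t 3^k |p|.

   Extremality of e and the vanishing of the Peirce components of m outside A both
   reduce to these facts: an isometry generator maps M to M (a component in N could
   be detected by the norm of m + n), and T m is a flat direction at e for
   T = L(e,b) - L(b,e), where b is the component of m transversal to A. Hence m and
   n lie in the JB-algebra A. Cubing e - sn, which has norm at most 1 for s in
   [0,1], and projecting to M shows that n^2 - n is a flat direction, so m and n are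
   complementary idempotents of A, and L(m,m) = L(m,e) gives the theorem. *)

(** * The norm as a real number *)

Section RealNorm.
Context {R : realType} {E : normedModType R[i]}.
Implicit Types (x y z : E) (s t : R).

(** The library norm of [E] takes values in [R[i]]; its real part lets estimates be made in the
    ordered field [R]. *)
Definition nrm x : R := complex.Re `|x|.

Lemma nrmE x : `|x| = (nrm x)%:C.
Proof. by rewrite /nrm RRe_real. Qed.

Lemma nrm_ge0 x : 0 <= nrm x.
Proof. by rewrite -lecR -nrmE rmorph0. Qed.

Lemma nrm_le1 x : (nrm x <= 1) = (`|x| <= 1).
Proof. by rewrite !nrmE -[X in _ = (_ <= X)](rmorph1 (real_complex R)) lecR. Qed.

Lemma nrmD x y : nrm (x + y) <= nrm x + nrm y.
Proof. by rewrite -lecR rmorphD/= -!nrmE ler_normD. Qed.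

Lemma nrm0 : nrm 0 = 0.
Proof. by rewrite /nrm normr0. Qed.

Lemma nrmN x : nrm (- x) = nrm x.
Proof. by rewrite /nrm normrN. Qed.

Lemma nrmB x y : nrm (x - y) <= nrm x + nrm y.
Proof. by rewrite -(nrmN y) nrmD. Qed.

Lemma nrm_eq0 x : nrm x = 0 -> x = 0.
Proof. by move=> h; apply/normr0_eq0; rewrite nrmE h. Qed.

Lemma nrmZc (a : R[i]) x : (nrm (a *: x))%:C = `|a| * (nrm x)%:C.
Proof. by rewrite -!nrmE normrZ. Qed.

Lemma normc_real t : `|t%:C| = (`|t|)%:C.
Proof. by rewrite normc_def /= expr0n addr0 sqrtr_sqr. Qed.

Lemma nrmZ t x : nrm (t%:C *: x) = `|t| * nrm x.
Proof. by apply: (@complexI R); rewrite nrmZc normc_real rmorphM. Qed.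

Lemma nrmZge0 t x : 0 <= t -> nrm (t%:C *: x) = t * nrm x.
Proof. by move=> t0; rewrite nrmZ ger0_norm. Qed.

End RealNorm.

(** * The Hahn-Banach theorem for the norm *)

Section HahnBanach.
Context {R : realType} {E : normedModType R[i]}.
Implicit Types (x y z : E) (s t : R) (p q : E -> R).

Definition sublinear p :=
  (forall x y, p (x + y) <= p x + p y) /\
  (forall t x, 0 < t -> p (t%:C *: x) <= t * p x).

Lemma sublinear0 p : sublinear p -> p 0 = 0.
Proof.
move=> [pD pZ]; apply/eqP; rewrite eq_le.
have h1 := pD 0 0; rewrite addr0 in h1.
have /(_ _)/= h2 := pZ (1/2) 0; rewrite scaler0 in h2.
by have := h2 ltac:(lra); lra.
Qed.

Lemma sublinearZ p t x : sublinear p -> 0 <= t -> p (t%:C *: x) = t * p x.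
Proof.
move=> sp; rewrite le_eqVlt => /predU1P[<-|t0].
  by rewrite rmorph0 scale0r sublinear0 // mul0r.
have [_ pZ] := sp; apply/eqP; rewrite eq_le pZ //=.
have ti0 : 0 < t^-1 by rewrite invr_gt0.
have := pZ _ (t%:C *: x) ti0; rewrite scalerA -rmorphM mulVf ?gt_eqF//.
by rewrite rmorph1 scale1r mulrC ler_pdivlMr // mulrC.
Qed.

Lemma sublinear_geN p x : sublinear p -> - p (- x) <= p x.
Proof.
move=> sp; have := sp.1 x (- x); rewrite subrr sublinear0 //; lra.
Qed.

(** Taking [t = 1] gives [tighten p y (- y) <= - p y], so an additive functional below [tighten p y]
    must take the value [p y] at [y]. *)
Definition tighten p y x :=
  inf [set p (x + t%:C *: y) - t * p y | t in [set t | 0 <= t]].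

Lemma tighten_lb p y x : sublinear p ->
  lbound [set p (x + t%:C *: y) - t * p y | t in [set t | 0 <= t]] (- p (- x)).
Proof.
move=> sp _ [t /= t0 <-]; rewrite -sublinearZ //.
have := sp.1 (x + t%:C *: y) (- x); rewrite addrAC subrr add0r; lra.
Qed.

Lemma tighten_le p y x t : sublinear p -> 0 <= t ->
  tighten p y x <= p (x + t%:C *: y) - t * p y.
Proof.
move=> sp t0; apply: ge_inf; last by exists t.
by exists (- p (- x)); exact: tighten_lb.
Qed.

Lemma le_tighten p y x r : (forall t, 0 <= t -> r <= p (x + t%:C *: y) - t * p y) ->
  r <= tighten p y x.
Proof.
move=> h; apply: lb_le_inf; first by exists (p (x + 0%:C *: y) - 0 * p y), 0 => /=.
by move=> _ [t t0 <-]; exact: h.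
Qed.

Lemma tighten_sublinear p y : sublinear p -> sublinear (tighten p y).
Proof.
move=> sp; split=> [x z|t x t0].
  rewrite -lerBlDr; apply: le_tighten => s s0.
  rewrite lerBlDr -lerBlDl; apply: le_tighten => u u0.
  have := tighten_le y (x + z) sp (addr_ge0 s0 u0).
  have := sp.1 (x + s%:C *: y) (z + u%:C *: y).
  by rewrite rmorphD/= scalerDl addrACA; lra.
rewrite -ler_pdivrMl //; apply: le_tighten => s s0.
have := tighten_le y (t%:C *: x) sp (mulr_ge0 (ltW t0) s0).
rewrite rmorphM/= -scalerA -scalerDr (sublinearZ _ sp (ltW t0)).
by rewrite ler_pdivrMl //; lra.
Qed.

Lemma tighten_le_self p y x : sublinear p -> tighten p y x <= p x.
Proof.
move=> sp; have := tighten_le y x sp (lexx 0).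
by rewrite rmorph0 scale0r addr0 mul0r subr0.
Qed.

(* If no sublinear q lies strictly below p then tighten p y = p for every y,
   which is additivity of p. *)
Lemma minimal_sublinear p : sublinear p ->
  (forall q, sublinear q -> (forall x, q x <= p x) -> q = p) ->
  (forall x y, p (x + y) = p x + p y) /\ (forall t x, p (t%:C *: x) = t * p x).
Proof.
move=> sp pmin.
have pD x y : p (x + y) = p x + p y.
  apply/eqP; rewrite eq_le sp.1 /=.
  have := tighten_le y x sp ler01.
  rewrite (pmin _ (tighten_sublinear y sp)); last by move=> ?; exact: tighten_le_self.
  by rewrite rmorph1 scale1r mul1r; lra.
split=> // t x; have [t0|t0] := leP 0 t; first exact: sublinearZ.
have := pD (t%:C *: x) ((- t)%:C *: x).
rewrite -scalerDl -rmorphD/= subrr rmorph0 scale0r sublinear0 //.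
by rewrite (sublinearZ x sp (_ : 0 <= - t)) ?oppr_ge0 ?ltW //; lra.
Qed.

Lemma exists_minimal_sublinear p0 : sublinear p0 ->
  exists p, [/\ sublinear p, (forall x, p x <= p0 x) &
    forall q, sublinear q -> (forall x, q x <= p x) -> q = p].
Proof.
move=> sp0.
pose T := {p : E -> R | sublinear p /\ forall x, p x <= p0 x}.
(* The order is reversed, so that a maximal element for Zorn is a pointwise minimal functional. *)
pose below (p q : T) := `[< forall x, sval q x <= sval p x >].
have [||||p pmax] := @Zorn T below.
- by move=> p; apply/asboolP.
- by move=> p q r /asboolP qp /asboolP rq; apply/asboolP => x; exact: le_trans (rq x) (qp x).
- move=> [p Pp] [q Pq] /asboolP/= qp /asboolP/= pq; apply: eq_exist.
  by apply/funext => x; apply/eqP; rewrite eq_le qp pq.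
- move=> A Atot; have [->|/set0P[a Aa]] := eqVneq A set0.
    by exists (exist _ p0 (conj sp0 (fun x => lexx _))).
  pose q x := inf [set sval p x | p in A].
  have qlb x : has_lbound [set sval p x | p in A].
    exists (- p0 (- x)) => _ [p Ap <-]; have [sp pp0] := svalP p.
    by have := sublinear_geN x sp; have := pp0 (- x); lra.
  have qle (p : T) x : A p -> q x <= sval p x by move=> Ap; apply: ge_inf => //; exists p.
  have leqq r x : (forall p : T, A p -> r <= sval p x) -> r <= q x.
    move=> h; apply: lb_le_inf; first by exists (sval a x), a.
    by move=> _ [p Ap <-]; exact: h.
  have sq : sublinear q.
    split=> [x y|t x t0].
      rewrite -lerBlDr; apply: (leqq) => p Ap; rewrite lerBlDr -lerBlDl; apply: (leqq) => r Ar.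
      rewrite lerBlDl.
      have [/asboolP rp|/asboolP pr] := Atot _ _ Ap Ar.
        have := qle _ (x + y) Ar; have := (svalP r).1.1 x y.
        by have := rp x; lra.
      have := qle _ (x + y) Ap; have := (svalP p).1.1 x y.
      by have := pr y; lra.
    rewrite -ler_pdivrMl //; apply: (leqq) => p Ap; rewrite ler_pdivrMl //.
    by apply: le_trans (qle _ _ Ap) _; exact: (svalP p).1.2.
  have qp0 x : q x <= p0 x by apply: le_trans (qle _ _ Aa) _; exact: (svalP a).2.
  exists (exist _ q (conj sq qp0)) => p Ap; apply/asboolP => x /=; exact: qle.
- exists (sval p); have [sp pp0] := svalP p; split=> // q sq qp.
  have qp0 x : q x <= p0 x by apply: le_trans (qp x) _.
  have /pmax/(congr1 sval) // : below p (exist _ q (conj sq qp0)) by apply/asboolP.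
Qed.

Lemma nrm_sublinear : sublinear (@nrm R E).
Proof. by split=> [|t x t0]; [exact: nrmD|rewrite nrmZge0 // ltW]. Qed.

Lemma real_norming_functional (x0 : E) : exists g : E -> R,
  [/\ forall x y, g (x + y) = g x + g y, forall t x, g (t%:C *: x) = t * g x,
      forall x, g x <= nrm x & g x0 = nrm x0].
Proof.
have snrm := nrm_sublinear.
(* Tightening the norm at [x0] before minimising forces [g x0 = nrm x0]. *)
have [g [sg gle gmin]] := exists_minimal_sublinear (tighten_sublinear x0 snrm).
have [gD gZ] := minimal_sublinear sg gmin.
have gnrm x : g x <= nrm x by apply: le_trans (gle x) _; exact: tighten_le_self.
exists g; split=> //; apply/eqP; rewrite eq_le gnrm /=.
have := le_trans (gle (- x0)) (tighten_le x0 (- x0) snrm ler01).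
rewrite rmorph1 scale1r addNr nrm0.
have := gZ (-1) x0; rewrite rmorphN1 scaleN1r => ->; lra.
Qed.

Lemma norming_functional (x0 : E) : exists f : E -> R[i],
  [/\ clinear_functional f, forall y, `|f y| <= `|y| & f x0 = `|x0|].
Proof.
have [g [gD gZ gle gx0]] := real_norming_functional x0.
have i2 : 'i%C * 'i%C = -1 :> R[i] by rewrite -expr2 sqr_i.
pose f (x : E) := (g x)%:C - 'i%C * (g ('i%C *: x))%:C.
have fD x y : f (x + y) = f x + f y.
  by rewrite /f scalerDr !gD !rmorphD/=; ring.
have fR t x : f (t%:C *: x) = t%:C * f x.
  by rewrite /f scalerA (mulrC 'i%C t%:C) -scalerA !gZ !rmorphM/=; ring.
have fI x : f ('i%C *: x) = 'i%C * f x.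
  rewrite /f scalerA i2; have := gZ (-1) x; rewrite rmorphN1 => ->.
  by rewrite mulN1r rmorphN/=; ring: i2.
have fZ a x : f (a *: x) = a * f x.
  rewrite [a]complexE scalerDl fD fR -scalerA fI fR; ring.
have Ref x : complex.Re (f x) = g x by rewrite /f /=; ring.
have fle y : `|f y| <= `|y|.
  have [->|fy0] := eqVneq (f y) 0; first by rewrite normr0.
  (* A unimodular factor turns [f y] into its modulus, which is then a value of [g]. *)
  pose a := `|f y| / f y.
  have a1 : `|a| = 1 by rewrite normrM normfV normr_id divff // normr_eq0.
  have fay : f (a *: y) = `|f y| by rewrite fZ /a divfK.
  have := gle (a *: y); rewrite -Ref fay -lecR RRe_real ?ger0_real // => h.
  by apply: le_trans h _; rewrite nrmZc a1 mul1r -nrmE.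
exists f; split => //; first by move=> a x y; rewrite fD fZ.
apply/eqP; rewrite eq_le; apply/andP.
have := fle x0; rewrite nrmE; case: (f x0) (Ref x0) => u v /= ->; rewrite gx0.
rewrite normc_def /= lecR => h.
suff -> : v = 0 by [].
have : nrm x0 ^+ 2 + v ^+ 2 <= nrm x0 ^+ 2.
  rewrite -(@ler_sqrt _ _ (nrm x0 ^+ 2)) ?sqr_ge0 // [X in _ <= X]sqrtr_sqr.
  by rewrite (ger0_norm (nrm_ge0 _)).
rewrite gerDl => h2; apply/eqP; rewrite -sqrf_eq0 eq_le h2 sqr_ge0 //.
Qed.

End HahnBanach.

Section Functionals.
Context {R : realType} {E : normedModType R[i]}.
Variable f : E -> R[i].
Hypothesis fl : clinear_functional f.

Lemma lfD x y : f (x + y) = f x + f y.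
Proof. by have := fl 1 x y; rewrite scale1r mul1r. Qed.

Lemma lf0 : f 0 = 0.
Proof. by apply: (@addrI _ (f 0)); rewrite -lfD !addr0. Qed.

Lemma lfZ a x : f (a *: x) = a * f x.
Proof. by have := fl a x 0; rewrite lf0 !addr0. Qed.

Lemma lfN x : f (- x) = - f x.
Proof. by rewrite -scaleN1r lfZ mulN1r. Qed.

End Functionals.

Lemma functional_sep {R : realType} {E : normedModType R[i]} (x y : E) :
  (forall f, clinear_functional f -> f x = f y) -> x = y.
Proof.
move=> h; apply/eqP; rewrite -subr_eq0; apply/eqP/nrm_eq0/(@complexI R).
have [f [fl _ fx]] := norming_functional (x - y).
by rewrite -nrmE -fx lfD // lfN // h // subrr.
Qed.

(* A linear identity between vectors holds if it holds under every functional,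
   which makes the scalar tactics available. *)
Ltac vec_field :=
  apply: functional_sep; let f := fresh "f" in let fl := fresh "fl" in
  intros f fl; rewrite ?(lfD fl, lfN fl, lfZ fl, lf0 fl); first [ring | field; rewrite ?pnatr_eq0 //].

Lemma mulii (R : realType) : 'i%C * 'i%C = -1 :> R[i].
Proof. by rewrite -expr2 sqr_i. Qed.

Ltac vec_ring_i :=
  apply: functional_sep; let f := fresh "f" in let fl := fresh "fl" in
  intros f fl; rewrite ?(lfD fl, lfN fl, lfZ fl, lf0 fl); 
  lazymatch goal with R : realType |- _ => ring: (mulii R) end.

(** * Generators of isometries *)

Section SkewOperators.
Context {R : realType} {E : normedModType R[i]}.
Implicit Types (x y z : E) (s t : R) (T H : E -> E).

Lemma clinD T x y : clinear T -> T (x + y) = T x + T y.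
Proof. by move=> Tl; have := Tl 1 x y; rewrite !scale1r. Qed.

Lemma clin0 T : clinear T -> T 0 = 0.
Proof. by move=> Tl; apply: (@addrI _ (T 0)); rewrite -(clinD _ _ Tl) !addr0. Qed.

Lemma clinZ T a x : clinear T -> T (a *: x) = a *: T x.
Proof. by move=> Tl; have := Tl a x 0; rewrite (clin0 Tl) !addr0. Qed.

Lemma clinN T x : clinear T -> T (- x) = - T x.
Proof. by move=> Tl; rewrite -scaleN1r (clinZ _ _ Tl) scaleN1r. Qed.

Definition norming x (f : E -> R[i]) :=
  [/\ clinear_functional f, forall y, `|f y| <= `|y| & f x = `|x|].

Lemma norming_Re_le x f y : norming x f -> complex.Re (f y) <= nrm y.
Proof.
move=> [_ fle _]; rewrite -lecR -nrmE; apply: le_trans (fle y).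
by apply: le_trans (normc_ge_Re _); rewrite lecR ler_norm.
Qed.

Lemma hermitian_norming H x f : clinear H -> hermitian_op H -> norming x f ->
  complex.Im (f (H x)) = 0.
Proof.
move=> Hl Hh [fl fle fx]; have [x0|x0] := eqVneq (nrm x) 0.
  by rewrite (nrm_eq0 x0) (clin0 Hl) lf0.
have r0 : (nrm x)%:C != 0 by rewrite fmorph_eq0.
have u1 : `|(nrm x)^-1%:C *: x| = 1.
  by rewrite nrmE nrmZge0 ?invr_ge0 ?nrm_ge0 // mulVf // rmorph1.
have fu : f ((nrm x)^-1%:C *: x) = 1.
  by rewrite (lfZ fl) fx nrmE -rmorphM mulVf // rmorph1.
have := Hh _ _ u1 fl fle fu; rewrite (clinZ _ _ Hl) (lfZ fl).
case: (f (H x)) => u v /=; rewrite mul0r addr0 => /eqP.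
by rewrite mulf_eq0 invr_eq0 (negbTE x0) => /eqP.
Qed.

(** Since [t] takes both signs, [T] and [- T] are both dissipative; for bounded [T] this says that
    every exp(tT) is an isometry, without mentioning exponentials. *)
Definition skew_op T := clinear T /\ forall t x, nrm x <= nrm (x + t%:C *: T x).

(** A functional norming [x] has real part [nrm x] on the whole line x + itHx, because its value at
    [H x] is real. *)
Lemma hermitian_skew H : clinear H -> hermitian_op H -> skew_op (fun x => 'i%C *: H x).
Proof.
move=> Hl Hh; split=> [a x y|t x].
  by rewrite Hl scalerDr !scalerA mulrC.
have [f nf] := norming_functional x; have Im0 := hermitian_norming Hl Hh nf.
apply: le_trans (norming_Re_le _ nf).
case: nf => fl _ fx; rewrite lfD // !lfZ // fx nrmE.
by move: Im0; case: (f (H x)) => u v /= ->; lra.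
Qed.

Lemma skew_ext T1 T2 : T1 =1 T2 -> skew_op T1 -> skew_op T2.
Proof.
move=> e [Tl Ts]; split=> [a x y|t x]; first by rewrite -!e Tl.
by rewrite -e.
Qed.

Lemma skewN T : skew_op T -> skew_op (fun x => - T x).
Proof.
move=> [Tl Ts]; split=> [a x y|t x]; first by rewrite Tl opprD scalerN.
by have := Ts (- t) x; rewrite rmorphN scaleNr scalerN.
Qed.

(** (1 - tT)(1 + tT) = 1 - t^2 T^2, and 1 - tT does not decrease the norm. *)
Lemma skew_first_order T t x : skew_op T ->
  nrm (x + t%:C *: T x) <= nrm x + t ^+ 2 * nrm (T (T x)).
Proof.
move=> [Tl Ts]; apply: le_trans (Ts (- t) _) _.
rewrite (clinD _ _ Tl) (clinZ _ _ Tl).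
have -> : x + t%:C *: T x + (- t)%:C *: (T x + t%:C *: T (T x))
    = x - (t ^+ 2)%:C *: T (T x) by vec_field.
by apply: le_trans (nrmB _ _) _; rewrite nrmZge0 // sqr_ge0.
Qed.

(* (1 - tT)(1 + tT + t^2 T^2) = 1 - t^3 T^3; averaging over the sign of t
   removes the odd term. *)
Lemma skew_second_order T t x : skew_op T -> 0 <= t ->
  nrm (x + (t ^+ 2)%:C *: T (T x)) <= nrm x + t ^+ 3 * nrm (T (T (T x))).
Proof.
move=> [Tl Ts] t0.
have half s : nrm (x + s%:C *: T x + (s ^+ 2)%:C *: T (T x)) <=
    nrm x + `|s| ^+ 3 * nrm (T (T (T x))).
  apply: le_trans (Ts (- s) _) _; rewrite !(clinD _ _ Tl) !(clinZ _ _ Tl).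
  have -> : x + s%:C *: T x + (s ^+ 2)%:C *: T (T x) + (- s)%:C *:
      (T x + s%:C *: T (T x) + (s ^+ 2)%:C *: T (T (T x)))
      = x - (s ^+ 3)%:C *: T (T (T x)) by vec_field.
  by apply: le_trans (nrmB _ _) _; rewrite nrmZ normrX.
have -> : x + (t ^+ 2)%:C *: T (T x) =
    (2^-1)%:C *: (x + t%:C *: T x + (t ^+ 2)%:C *: T (T x)) +
    (2^-1)%:C *: (x + (- t)%:C *: T x + ((- t) ^+ 2)%:C *: T (T x)) by vec_field.
apply: le_trans (nrmD _ _) _; rewrite !nrmZge0 ?invr_ge0 //.
have := half t; have := half (- t); rewrite normrN ger0_norm //.
by move: (nrm _) (nrm _) (nrm _) (_ * _) => a b c d; lra.
Qed.

(** Apply [f] to the second-order estimate, divide by t^2 and let t tend to 0. *)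
Lemma norming_skew_sqr T x f : skew_op T -> norming x f ->
  complex.Re (f (T (T x))) <= 0.
Proof.
move=> sT nf; have [fl _ fx] := nf.
have key t : 0 < t -> complex.Re (f (T (T x))) <= t * nrm (T (T (T x))).
  move=> t0; have := le_trans (norming_Re_le _ nf) (skew_second_order x sT (ltW t0)).
  rewrite lfD // lfZ // fx nrmE; case: (f (T (T x))) => u v /=.
  have -> a : t ^+ 3 * a = t ^+ 2 * (t * a) by ring.
  by rewrite mul0r subr0 lerD2l ler_pM2l // exprn_gt0.
apply/ler_addgt0Pl => eps eps0; rewrite addr0.
have n0 := nrm_ge0 (T (T (T x))).
apply: le_trans (key (eps / (1 + nrm (T (T (T x))))) _) _.
  by rewrite divr_gt0 //; lra.
by rewrite mulrAC ler_pdivrMr ?ler_pM2l //; lra.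
Qed.

End SkewOperators.

(** * Vector identities as explicit combinations of hypotheses *)

Section LinearCombination.
Context {R : realType} {V : normedModType R[i]}.
Implicit Types (x y l r : V) (a b : R[i]).

Lemma lincomb1 a l r x y : l = r -> x - y = a *: (l - r) -> x = y.
Proof. by move=> -> /eqP; rewrite subrr scaler0 subr_eq0 => /eqP. Qed.

Lemma lincomb2 a b l r l' r' x y : l = r -> l' = r' ->
  x - y = a *: (l - r) + b *: (l' - r') -> x = y.
Proof. by move=> -> -> /eqP; rewrite !subrr !scaler0 addr0 subr_eq0 => /eqP. Qed.

End LinearCombination.
Arguments lincomb1 {R V} a {l r x y}.
Arguments lincomb2 {R V} a b {l r l' r' x y}.

(** * Triple product, Peirce calculus and powers *)

Section JBTriple.
Context {R : realType} {E : normedModType R[i]} (tp : E -> E -> E -> E).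
Hypothesis JB : is_JBstar_triple tp.
Implicit Types (a b c x y z u v w : E) (r s t : R).

Lemma tpC x y z : tp x y z = tp z y x.
Proof. by case: JB => _ [_ [h _]]. Qed.

Lemma tp_clinear x y : clinear (tp x y).
Proof. by case: JB => _ [h _] _ _ _ r u v; rewrite (tpC x y (_ + _)) h (tpC u) (tpC v). Qed.

Lemma tpDr x y u v : tp x y (u + v) = tp x y u + tp x y v.
Proof. exact: clinD (tp_clinear x y). Qed.

Lemma tpDl x y u v : tp (u + v) x y = tp u x y + tp v x y.
Proof. by rewrite tpC tpDr (tpC y x u) (tpC y x v). Qed.

Lemma tpZr (k : R[i]) x y z : tp x y (k *: z) = k *: tp x y z.
Proof. exact: clinZ (tp_clinear x y). Qed.

Lemma tpZl (k : R[i]) x y z : tp (k *: x) y z = k *: tp x y z.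
Proof. by rewrite tpC tpZr tpC. Qed.

Lemma tpNr x y z : tp x y (- z) = - tp x y z.
Proof. exact: clinN (tp_clinear x y). Qed.

Lemma tpNl x y z : tp (- x) y z = - tp x y z.
Proof. by rewrite tpC tpNr tpC. Qed.

Lemma tp0r x y : tp x y 0 = 0.
Proof. exact: clin0 (tp_clinear x y). Qed.

Lemma tp0l x y : tp 0 x y = 0.
Proof. by rewrite tpC tp0r. Qed.

Lemma tpDm x y u v : tp x (u + v) y = tp x u y + tp x v y.
Proof.
case: JB => _ [_ [_ h]] _ _ _; have := h 1 x u v y.
by rewrite conjC1 !scale1r.
Qed.

Lemma tp0m x y : tp x 0 y = 0.
Proof. by apply: (@addrI _ (tp x 0 y)); rewrite -(tpDm x y) !addr0. Qed.

Lemma tpZmc (k : R[i]) x y z : tp x (k *: y) z = (k^*)%R *: tp x y z.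
Proof.
case: JB => _ [_ [_ h]] _ _ _; have := h k x y 0 z.
by rewrite tp0m !addr0.
Qed.

Lemma tpZm t x y z : tp x (t%:C *: y) z = t%:C *: tp x y z.
Proof. by rewrite tpZmc conj_Creal // complex_real. Qed.

Lemma tpZmi x y z : tp x ('i%C *: y) z = - ('i%C *: tp x y z).
Proof. by rewrite tpZmc complexiE conjCi scaleNr. Qed.

Lemma tpNm x y z : tp x (- y) z = - tp x y z.
Proof. by have := tpZm (-1) x y z; rewrite rmorphN rmorph1 !scaleN1r. Qed.

Definition tpE := (tpDl, tpDm, tpDr, tpNl, tpNm, tpNr, tpZm, tpZmi, tpZl, tpZr,
  tp0l, tp0m, tp0r).

Lemma jordan a b x y z :
  tp a b (tp x y z) = tp (tp a b x) y z - tp x (tp b a y) z + tp x y (tp a b z).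
Proof. by case: JB => _ _ _ [h _] _. Qed.

Lemma tp_cube_norm x : nrm (tp x x x) = nrm x ^+ 3.
Proof.
case: JB => _ _ _ _ h; apply: (@complexI R).
by rewrite rmorphXn /= -!nrmE h.
Qed.

Lemma tp_hermitian a : hermitian_op (tp a a).
Proof. by case: JB => _ _ _ [_ h] _; have [] := h a. Qed.

(** By polarisation L(a,b) + L(b,a) = L(a+b,a+b) - L(a,a) - L(b,b), which is Hermitian. *)
Lemma skew_sym a b : skew_op (fun x => 'i%C *: (tp a b x + tp b a x)).
Proof.
have e x : tp a b x + tp b a x = tp (a + b) (a + b) x - tp a a x - tp b b x.
  by rewrite !tpE; vec_field.
apply: (@hermitian_skew _ _ (fun x => tp a b x + tp b a x)) => [k x y|x f x1 fl fle fx].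
  by rewrite !tpE; vec_field.
rewrite e !lfD // !lfN // !raddfD !raddfN /=.
by rewrite !(tp_hermitian _ x1 fl fle fx) !subr0.
Qed.

(* i (L(a,b) - L(b,a)) = L(a,a) + L(b,b) - L(a+ib, a+ib) is Hermitian. *)
Lemma skew_derivation a b : skew_op (fun x => tp a b x - tp b a x).
Proof.
have e x : 'i%C *: (tp a b x - tp b a x) = tp a a x + tp b b x - tp (a + 'i%C *: b) (a + 'i%C *: b) x.
  by rewrite !tpE; vec_ring_i.
have := @hermitian_skew _ _ (fun x => 'i%C *: (tp a b x - tp b a x)).
move=> /(_ _)/= []//.
- by move=> k x y; rewrite !tpE; vec_field.
- move=> x f x1 fl fle fx; rewrite e !lfD // !lfN // !raddfD !raddfN /=.
  by rewrite !(tp_hermitian _ x1 fl fle fx) subr0 addr0.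
move=> l s; apply: (@skew_ext _ _ (fun x => - ('i%C *: ('i%C *: (tp a b x - tp b a x))))).
  by move=> x; rewrite scalerA -expr2 sqr_i scaleN1r opprK.
exact: skewN.
Qed.

End JBTriple.

(** * Peirce calculus and powers at a tripotent *)

Section Peirce.
Context {R : realType} {E : normedModType R[i]} (tp : E -> E -> E -> E).
Hypothesis JB : is_JBstar_triple tp.
Variable e : E.
Hypothesis ee : tp e e e = e.
Implicit Types (a b c x y z u v w : E) (r s t : R).

Let tpE := (tpE JB).
Let tpC := (tpC JB).
Let jordan := (jordan JB).

(** Expand L(x,e) applied to {e,e,e}. The right side sends the eigenvalues 1, 1/2, 0 of L(e,e) to 1,
    0, 0: it is the Peirce-2 projection. *)
Lemma peirce_QQ x : tp e (tp e x e) e = 2 *: tp e e (tp e e x) - tp e e x.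
Proof.
have := jordan x e e e e; rewrite ee (tpC x e e) (tpC (tp e e x)) => h.
by apply: (lincomb1 1 h); vec_field.
Qed.

(** Two instances of the Jordan identity form a linear system with the two left-hand sides as
    unknowns. *)
Lemma peirce_DQ_QD x : tp e e (tp e x e) = tp e x e /\ tp e (tp e e x) e = tp e x e.
Proof.
have h1 := jordan e e e x e; have h2 := jordan e x e e e.
rewrite ee (tpC x e e) (tpC (tp e x e) e e) in h1 h2.
have h : tp e e (tp e x e) = tp e x e.
  apply: (lincomb2 3^-1 (- 3^-1) h1 h2); vec_field.
by split=> //; apply: (lincomb2 1 (-1) h1 h); vec_field.
Qed.

Lemma peirce_DQ x : tp e e (tp e x e) = tp e x e.
Proof. by have [] := peirce_DQ_QD x. Qed.

Lemma peirce_QD x : tp e (tp e e x) e = tp e x e.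
Proof. by have [] := peirce_DQ_QD x. Qed.

(* The Peirce-2 elements fixed by the involution Q(e); E_2(e) = A + iA for this A. *)
Definition selfadj a := tp e a e = a.

Lemma selfadj_D a : selfadj a -> tp e e a = a.
Proof. by move=> sa; rewrite -[in LHS]sa peirce_DQ. Qed.

Lemma selfadj_e : selfadj e. Proof. exact: ee. Qed.

Lemma selfadj_D' a : selfadj a -> tp a e e = a.
Proof. by move=> sa; rewrite tpC selfadj_D. Qed.

Lemma selfadj_lin a b r s : selfadj a -> selfadj b ->
  selfadj (r%:C *: a + s%:C *: b).
Proof. by move=> sa sb; rewrite /selfadj !tpE sa sb. Qed.

(** One Jordan identity shows that L(e,e) and L(e,a) commute; in the other their commutator equals
    L(e,a) - L(a,e). *)
Lemma selfadj_comm a y : selfadj a -> tp a e y = tp e a y.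
Proof.
move=> sa; have h1 := jordan e a e e y; have h2 := jordan e e e a y.
rewrite sa (selfadj_D' sa) in h1; rewrite ee (selfadj_D sa) in h2.
by apply: (lincomb2 (-1) (-1) h1 h2); vec_field.
Qed.

(** The operation {a,e,b} is the Jordan product of the algebra A, with unit [e]; [jpow] below gives
    its powers. *)
Lemma selfadj_mul a b : selfadj a -> selfadj b -> selfadj (tp a e b).
Proof.
move=> sa sb; have h := jordan e a e b e; rewrite /selfadj.
rewrite sa sb (tpC a b e) -(selfadj_comm _ sa) -(selfadj_comm _ sb) (tpC b) in h.
by apply: (lincomb1 1 h); vec_field.
Qed.

Section Powers.
Variable p : E.
Hypothesis sp : selfadj p.

Definition jpow n := iter n (tp p e) e.

Lemma jpowS n : jpow n.+1 = tp p e (jpow n). Proof. by []. Qed.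

Lemma jpow1 : jpow 1 = p. Proof. exact: selfadj_D'. Qed.

Lemma selfadj_jpow n : selfadj (jpow n).
Proof. by elim: n => [|n IH]; [exact: selfadj_e|exact: selfadj_mul]. Qed.

(* With X = [L(p^n,e), L(p,e)] the operators L(p^i,p^(n+1-i)) form an arithmetic
   progression of difference X whose two ends agree, hence X = 0. *)
Lemma jpow_box i j y : tp (jpow i) (jpow j) y = tp (jpow (i + j)) e y.
Proof.
move def_n : (i + j)%N => n; elim: n i j def_n y => [|n IH] i j.
  by move=> /eqP; rewrite addn_eq0 => /andP[/eqP-> /eqP->].
move=> ij y; pose T n y := tp (jpow n) e y.
pose X := T n (tp p e y) - tp p e (T n y).
have step k : (k <= n)%N ->
    tp (jpow k.+1) (jpow (n - k)) y = tp (jpow k) (jpow (n - k).+1) y - X.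
  move=> kn; have h := jordan p e (jpow k) (jpow (n - k)) y.
  rewrite !IH ?subnKC // -(selfadj_comm _ sp) -!jpowS in h.
  by apply: (lincomb1 (-1) h); rewrite /X /T; vec_field.
have prog k : (k <= n.+1)%N ->
    tp (jpow k) (jpow (n.+1 - k)) y = T n.+1 y - k%:R *: X.
  elim: k => [|k IHk] kn.
    by rewrite subn0 scale0r subr0 -selfadj_comm //; exact: selfadj_jpow.
  rewrite subSS step // -subSn // IHk; last exact: ltnW.
  by rewrite (mulrSr 1); vec_field.
have X0 : X = 0.
  have := prog n.+1 (leqnn _); rewrite subnn => /eqP.
  rewrite -subr_eq0 opprB addrC subrK scaler_eq0 pnatr_eq0 /= => /eqP //.
have := prog i; rewrite -ij leq_addr addKn X0 scaler0 subr0; exact.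
Qed.

(** The Jordan identity expresses the commutator through L(p^(n+1),e) - L(p^n,p), which vanishes by
    [jpow_box]. *)
Lemma jpow_comm n y : tp (jpow n) e (tp p e y) = tp p e (tp (jpow n) e y).
Proof.
have h := jordan p e (jpow n) e y.
have h' := jpow_box n 1 y; rewrite jpow1 addn1 in h'.
rewrite -/(jpow n.+1) -jpowS sp h' in h.
by apply: (lincomb1 (-1) h); vec_field.
Qed.

Lemma jpow_mul i j k : tp (jpow i) (jpow j) (jpow k) = jpow (i + j + k).
Proof.
rewrite jpow_box; elim: k => [|k IH]; first by rewrite addn0 selfadj_D' //; exact: selfadj_jpow.
by rewrite jpowS jpow_comm IH -jpowS addnS.
Qed.

Lemma nrm_jpow k : nrm (jpow (3 ^ k)) = nrm p ^+ (3 ^ k).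
Proof.
elim: k => [|k IH]; first by rewrite jpow1 expr1.
rewrite expnS mulnC exprM -IH -(tp_cube_norm JB) jpow_mul.
by congr (nrm (jpow _)); lia.
Qed.

End Powers.

End Peirce.

(** * Flat directions of the norm at a tripotent *)

Section OneSidedDerivative.
Context {R : realType} {E : normedModType R[i]}.
Implicit Types (z a b x : E) (r s t C eps delta : R).

(* When nrm z = 1: the one-sided derivative of the norm at z in direction a is
   at most 0. *)
Definition dnorm_le0 z a := forall eps, 0 < eps -> exists2 delta, 0 < delta &
  forall t, 0 < t -> t < delta -> nrm (z + t%:C *: a) <= 1 + eps * t.

Lemma dnorm_le0D z a b : dnorm_le0 z a -> dnorm_le0 z b -> dnorm_le0 z (a + b).
Proof.
move=> ha hb eps eps0; have eps20 : 0 < eps / 2 by rewrite divr_gt0.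
have [da da0 Ha] := ha _ eps20; have [db db0 Hb] := hb _ eps20.
exists (Num.min da db / 2) => [|t t0]; first by rewrite divr_gt0 // lt_min da0.
rewrite ltr_pdivlMr // lt_min => /andP[ta tb].
have -> : z + t%:C *: (a + b) =
    (2^-1)%:C *: (z + (t * 2)%:C *: a) + (2^-1)%:C *: (z + (t * 2)%:C *: b).
  by vec_field.
apply: le_trans (nrmD _ _) _; rewrite !nrmZge0 ?invr_ge0 //.
have := Ha _ _ ta; have := Hb _ _ tb.
move: (nrm _) (nrm _) => u v; have t20 : 0 < t * 2 by rewrite mulr_gt0.
by move=> /(_ t20) h1 /(_ t20) h2; lra.
Qed.

Lemma dnorm_le0Z z a r : 0 < r -> dnorm_le0 z a -> dnorm_le0 z (r%:C *: a).
Proof.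
move=> r0 ha eps eps0; have [d d0 H] := ha (eps / r) (divr_gt0 eps0 r0).
exists (d / r) => [|t t0]; first by rewrite divr_gt0.
rewrite ltr_pdivlMr // => td; have := H _ (mulr_gt0 t0 r0) td.
rewrite scalerA -rmorphM; have -> // : eps * t = eps / r * (t * r) by field; rewrite gt_eqF.
Qed.

(** With t = s^2 the error s^3 is t^(3/2), hence o(t). This suits second-order expansions along a
    curve with parameter s. *)
Lemma dnorm_le0_cubic z a C :
  (forall s, 0 < s -> s <= 1 -> nrm (z + (s ^+ 2)%:C *: a) <= 1 + C * s ^+ 3) ->
  dnorm_le0 z a.
Proof.
move=> h eps eps0; pose C' := `|C| + 1; have C'0 : 0 < C' by rewrite ltr_wpDl.
exists (Num.min 1 ((eps / C') ^+ 2)) => [|t t0].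
  by rewrite lt_min ltr01 exprn_gt0 // divr_gt0.
rewrite lt_min => /andP[t1 td]; pose s := Num.sqrt t.
have s0 : 0 < s by rewrite sqrtr_gt0.
have ts : t = s ^+ 2 by rewrite sqr_sqrtr // ltW.
have s1 : s <= 1 by rewrite /s -[leRHS]sqrtr1 ler_sqrt // ltW.
have sd : s * C' <= eps.
  rewrite -ler_pdivlMr // -(@ler_pXn2r _ 2) ?nnegrE ?divr_ge0 ?(ltW s0) ?(ltW C'0) ?(ltW eps0) // -ts; exact: ltW.
rewrite ts; apply: le_trans (h _ s0 s1) _; rewrite lerD2l.
have -> : C * s ^+ 3 = (s * C) * s ^+ 2 by ring.
rewrite ler_pM2r ?exprn_gt0 //; apply: le_trans sd; rewrite ler_pM2l //.
by rewrite /C'; have := ler_norm C; lra.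
Qed.

Lemma dnorm_le0_quadratic z a C :
  (forall t, 0 < t -> t <= 1 -> nrm (z + t%:C *: a) <= 1 + C * t ^+ 2) ->
  dnorm_le0 z a.
Proof.
move=> h; apply: (@dnorm_le0_cubic _ _ `|C|) => s s0 s1.
apply: le_trans (h (s ^+ 2) _ _) _; rewrite ?exprn_gt0 ?exprn_ile1 ?(ltW s0) //.
rewrite lerD2l; apply: (@le_trans _ _ (`|C| * (s ^+ 2) ^+ 2)).
  by rewrite ler_wpM2r ?ler_norm // exprn_ge0 // sqr_ge0.
rewrite ler_wpM2l // -exprM ler_wiXn2l ?(ltW s0) //.
Qed.

Lemma skew_dnorm_le0 z (T : E -> E) : skew_op T -> nrm z <= 1 -> dnorm_le0 z (T z).
Proof.
move=> sT z1; apply: (@dnorm_le0_quadratic _ _ (nrm (T (T z)))) => t t0 t1.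
by apply: le_trans (skew_first_order _ _ sT) _; rewrite mulrC lerD2r.
Qed.

Lemma skew_sqr_dnorm_le0 z (T : E -> E) : skew_op T -> nrm z <= 1 ->
  dnorm_le0 z (T (T z)).
Proof.
move=> sT z1; apply: (@dnorm_le0_cubic _ _ (nrm (T (T (T z))))) => t t0 t1.
by apply: le_trans (skew_second_order _ sT (ltW t0)) _; rewrite mulrC lerD2r.
Qed.

End OneSidedDerivative.

(** Used with nx = 1/2, where it bounds (1 + x)^n by 2. *)
Lemma bernoulli_inv {R : realFieldType} (x : R) n : 0 <= x ->
  (1 + x) ^+ n * (1 - n%:R * x) <= 1.
Proof.
move=> x0; elim: n => [|n IH]; first by rewrite expr0; lra.
apply: le_trans IH; rewrite exprSr -mulrA ler_wpM2l ?exprn_ge0 //; first lra.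
have n0 : 0 <= n%:R :> R by [].
by rewrite mulrSr; nra.
Qed.

(** * No flat directions inside the self-adjoint part *)

Section Flat.
Context {R : realType} {E : normedModType R[i]} (tp : E -> E -> E -> E).
Hypothesis JB : is_JBstar_triple tp.
Variable e : E.
Hypothesis ee : tp e e e = e.
Implicit Types (a b c x y z u v w : E) (r s t : R).

Let tpE := (tpE JB).

Lemma skew_selfadj a : selfadj tp e a -> skew_op (fun x => 'i%C *: tp a e x).
Proof.
move=> sa; have [l s] := skew_sym JB a e.
have e2 x : 'i%C *: (tp a e x + tp e a x) = 2 *: ('i%C *: tp a e x).
  by rewrite -(selfadj_comm JB ee x sa); vec_field.
split=> [k x y|t x]; first by rewrite !tpE; vec_field.
have := s (t / 2) x; rewrite e2; congr (_ <= nrm (_ + _)); vec_field.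
Qed.

(** For the generator T = iL(p^j,e) one has T(Tp) = - p^(2j+1). *)
Lemma norming_jpow_odd p (f : E -> R[i]) j : selfadj tp e p -> norming p f ->
  0 <= complex.Re (f (jpow tp e p (2 * j).+1)).
Proof.
move=> sp nf; have [fl _ _] := nf.
have sj := selfadj_jpow JB ee sp j.
have := norming_skew_sqr (skew_selfadj sj) nf.
have -> : 'i%C *: tp (jpow tp e p j) e ('i%C *: tp (jpow tp e p j) e p) =
    - jpow tp e p (2 * j).+1.
  have h1 : tp (jpow tp e p j) e p = jpow tp e p (j + 0 + 1).
    by rewrite -(jpow_mul JB ee sp) (jpow1 JB ee sp).
  have h2 := jpow_mul JB ee sp j 0 (j + 0 + 1); rewrite [jpow tp e p 0]/= in h2.
  rewrite !tpE h1 h2 scalerA mulii scaleN1r; congr (- jpow tp e p _); lia.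
by rewrite lfN // raddfN /= oppr_le0.
Qed.

(* The odd part of (e + sp)^n is a combination with nonnegative coefficients
   of odd powers of p, with linear coefficient ns. *)
Lemma jpow_odd_part p (f : E -> R[i]) s n : selfadj tp e p -> norming p f -> 0 <= s ->
  (n%:R * s) * nrm p <=
  complex.Re (f (jpow tp e (e + s%:C *: p) n - jpow tp e (e - s%:C *: p) n)) / 2.
Proof.
move=> sp nf s0; have [fl _ fp] := nf.
pose M := tp p e.
(* [u] and [v] are the parts of (e + sp)^n even and odd in s. *)
pose uv := fix uv n := if n is n'.+1 then
  let: (u, v) := uv n' in (u + s%:C *: M v, v + s%:C *: M u) else (e, 0).
have Mit i j : iter i M (jpow tp e p j) = jpow tp e p (i + j).
  by elim: i => [|i IH] //=; rewrite IH.
have MD i x y : iter i M (x + s%:C *: y) = iter i M x + s%:C *: iter i M y.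
  by elim: i => [|i IH] //=; rewrite IH /M !tpE.
have M0 i : iter i M 0 = 0 by elim: i => //= i ->; rewrite /M tpE.
have key m : let: (u, v) := uv m in
  [/\ jpow tp e (e + s%:C *: p) m = u + v, jpow tp e (e - s%:C *: p) m = u - v,
      (forall i, 0 <= complex.Re (f (iter (2 * i).+1 M u))) /\
      (forall i, 0 <= complex.Re (f (iter (2 * i) M v))),
      nrm p <= complex.Re (f (M u)) & (m%:R * s) * nrm p <= complex.Re (f v)].
  have fRe x y : complex.Re (f (x + s%:C *: y)) =
      complex.Re (f x) + s * complex.Re (f y).
    by rewrite lfD // lfZ //; case: (f x) (f y) => ? ? [? ?] /=; ring.
  elim: m => [|m /=].
    split=> /=.
    - by rewrite addr0.
    - by rewrite subr0.
    - split=> i; last by rewrite M0 lf0.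
      by have := norming_jpow_odd i sp nf; rewrite -(addn0 (2 * i).+1) -Mit.
    - by rewrite /M (selfadj_D' JB ee sp) fp nrmE.
    - by rewrite !mul0r lf0.
  case: (uv m) => u v [hp hm [hu hv] h1 h2].
  have su : tp e e u = u /\ tp e e v = v.
    have ss r : selfadj tp e (e + r%:C *: p).
      have := selfadj_lin JB 1 r ee sp; rewrite rmorph1 scale1r //.
    have h3 := selfadj_D JB ee (selfadj_jpow JB ee (ss s) m).
    have h4 := selfadj_D JB ee (selfadj_jpow JB ee (ss (- s)) m).
    rewrite rmorphN scaleNr hm !tpE in h4; rewrite hp !tpE in h3.
    split; first by apply: (lincomb2 2^-1 2^-1 h3 h4); vec_field.
    by apply: (lincomb2 2^-1 (- 2^-1) h3 h4); vec_field.
  split.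
  - by rewrite -/(jpow tp e (e + s%:C *: p) m) hp !tpE su.1 su.2 -/M; vec_field.
  - by rewrite -/(jpow tp e (e - s%:C *: p) m) hm !tpE su.1 su.2 -/M; vec_field.
  - split=> i.
      rewrite -iterS MD fRe -iterSr; apply: addr_ge0; first exact: hu.
      by apply: mulr_ge0 => //; have := hv i.+1; rewrite mulnS.
    rewrite MD fRe -iterSr; apply: addr_ge0; first exact: hv.
    by apply: mulr_ge0 => //; exact: hu.
  - rewrite /M !tpE -/M fRe; have := hv 1%N; rewrite muln1 /= => h3.
    by have := mulr_ge0 s0 h3; lra.
  - rewrite fRe mulrSr !mulrDl mul1r; have := ler_wpM2l s0 h1; lra.
have := key n; case: (uv n) => u v [-> -> _ _ h].
have -> : u + v - (u - v) = 2%:R *: v by vec_field.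
apply: le_trans h _; rewrite lfZ // -(rmorph_nat (real_complex R)).
by case: (f v) => a b /=; lra.
Qed.

Lemma flat_selfadj_eq0 p : selfadj tp e p -> dnorm_le0 e p -> dnorm_le0 e (- p) ->
  p = 0.
Proof.
move=> sp hp hm; apply/nrm_eq0/eqP; rewrite eq_le nrm_ge0 andbT.
have [f nf] := norming_functional p.
suff h tau : 0 < tau -> tau * nrm p <= 2.
  have [//|p0] := leP (nrm p) 0.
  have p3 : 0 < 3 / nrm p by rewrite divr_gt0.
  by have := h _ p3; rewrite divfK ?gt_eqF // ler_nat.
(* With ns = tau this slope gives n * eps * s = 1/2, so both powers (e + sp)^n and (e - sp)^n have
   norm at most 2. *)
move=> tau0; have eps0 : 0 < (2 * tau)^-1 by rewrite invr_gt0 mulr_gt0.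
have [dp dp0 Hp] := hp _ eps0; have [dm dm0 Hm] := hm _ eps0.
have d0 : 0 < Num.min dp dm by rewrite lt_min dp0.
(* The exponent is a power of 3, as [nrm_jpow] requires, large enough to bring [s] below both
   thresholds. *)
pose k := Num.truncn (tau / Num.min dp dm).
pose n := (3 ^ k.+1)%N; have n0 : 0 < n%:R :> R by rewrite ltr0n expn_gt0.
pose s := tau / n%:R; have s0 : 0 < s by rewrite divr_gt0.
have : s < Num.min dp dm.
  rewrite ltr_pdivrMr // mulrC -ltr_pdivrMr //.
  apply: lt_trans (truncnS_gt _) _; rewrite ltr_nat.
  exact: ltn_expl.
rewrite lt_min => /andP[sdp sdm].
have bound q : selfadj tp e q -> nrm q <= 1 + (2 * tau)^-1 * s ->
    nrm (jpow tp e q n) <= 2.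
  move=> sq qs; rewrite (nrm_jpow JB ee sq).
  apply: le_trans (lerXn2r _ _ _ qs) _; rewrite ?nnegrE ?nrm_ge0 //.
    by rewrite addr_ge0 // mulr_ge0 // ltW.
  have := bernoulli_inv n (mulr_ge0 (ltW eps0) (ltW s0)).
  have -> : 1 - n%:R * ((2 * tau)^-1 * s) = 2^-1.
    by rewrite /s; field; rewrite !gt_eqF.
  by rewrite ler_pdivrMr // mul1r.
have ss r : selfadj tp e (e + r%:C *: p).
  by have := selfadj_lin JB 1 r ee sp; rewrite rmorph1 scale1r.
have bp := bound _ (ss s) (Hp _ s0 sdp).
have bm : nrm (jpow tp e (e - s%:C *: p) n) <= 2.
  by rewrite -scaleNr -rmorphN; apply: bound; [exact: ss|rewrite rmorphN scaleNr -scalerN; exact: Hm].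
have := jpow_odd_part n sp nf (ltW s0).
have -> : n%:R * s = tau by rewrite /s mulrC divfK ?gt_eqF.
have := norming_Re_le (jpow tp e (e + s%:C *: p) n - jpow tp e (e - s%:C *: p) n) nf.
have := nrmB (jpow tp e (e + s%:C *: p) n) (jpow tp e (e - s%:C *: p) n).
by lra.
Qed.

End Flat.

Section RealSubspaces.
Context {R : realType} {E : normedModType R[i]} (W : set E).
Hypothesis Wsub : real_subspace W.
Implicit Types (x y : E) (r : R).

Lemma rsubZ r x : W x -> W (r%:C *: x). Proof. by case: Wsub => _ _; exact. Qed.

Lemma rsubD x y : W x -> W y -> W (x + y). Proof. by case: Wsub => _ h _; exact: h. Qed.

Lemma rsubN x : W x -> W (- x).
Proof. by move=> /(rsubZ (-1)); rewrite rmorphN rmorph1 scaleN1r. Qed.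

Lemma rsubB x y : W x -> W y -> W (x - y).
Proof. by move=> Wx /rsubN; exact: rsubD. Qed.

End RealSubspaces.

(** * The parts transversal to the self-adjoint elements *)

Section PeirceParts.
Context {R : realType} {E : normedModType R[i]} (tp : E -> E -> E -> E).
Hypothesis JB : is_JBstar_triple tp.
Variable e : E.
Hypothesis ee : tp e e e = e.
Implicit Types (a b c x y z u v w h k : E) (r s t : R).

Let tpE := (tpE JB).
Let tpC := (tpC JB).
Let jordan := (jordan JB).

Definition skewadj k := tp e k e = - k.
Definition peirce1 y := tp e e y = (2^-1)%:C *: y /\ tp e y e = 0.
(* The projection onto the self-adjoint elements along all the other Peirce parts,
   since Q(e)^2 is the Peirce-2 projection. *)
Definition hpart x := (2^-1)%:C *: (tp e (tp e x e) e + tp e x e).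

Lemma peirce_QQQ x : tp e (tp e (tp e x e) e) e = tp e x e.
Proof.
by rewrite (peirce_QQ JB ee (tp e x e)) !(peirce_DQ JB ee); vec_field.
Qed.

Lemma selfadj_hpart x : selfadj tp e (hpart x).
Proof. by rewrite /selfadj /hpart !tpE peirce_QQQ; vec_field. Qed.

Lemma hpartN x : hpart (- x) = - hpart x.
Proof. by rewrite /hpart !tpE; vec_field. Qed.

Lemma nrm_tripotent_le1 : nrm e <= 1.
Proof.
have := tp_cube_norm JB e; rewrite ee => h; rewrite leNgt; apply/negP => e1.
have : nrm e < nrm e ^+ 3 by rewrite ltr_eXnr.
by rewrite -h ltxx.
Qed.

(** This transfers the product rules of A to skew elements. *)
Lemma skewadj_i k : skewadj k -> selfadj tp e ('i%C *: k).
Proof. by move=> sk; rewrite /selfadj !tpE sk scalerN opprK. Qed.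

Lemma skewadj_D k : skewadj k -> tp e e k = k.
Proof.
move=> sk; have := peirce_DQ JB ee k; rewrite sk !tpE => h.
by apply: oppr_inj.
Qed.

Lemma skewadj_comm k y : skewadj k -> tp e k y = - tp k e y.
Proof.
move=> sk; have := selfadj_comm JB ee y (skewadj_i sk); rewrite !tpE => h.
apply: (lincomb1 (- 'i%C) h); vec_ring_i.
Qed.

Lemma skewadj_mul k a : skewadj k -> selfadj tp e a -> skewadj (tp k e a).
Proof.
move=> sk sa; have := selfadj_mul JB ee (skewadj_i sk) sa.
rewrite /selfadj !tpE => h; apply: (lincomb1 'i%C h); vec_ring_i.
Qed.

Lemma skewadj_sqr k : skewadj k -> selfadj tp e (tp k e k).
Proof.
move=> sk; have := selfadj_mul JB ee (skewadj_i sk) (skewadj_i sk).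
rewrite /selfadj !tpE => h; apply: (lincomb1 (-1) h); vec_ring_i.
Qed.

Lemma annihilated_mul y a : tp e y e = 0 ->
  tp e y (tp e a e) = 0 /\ tp e (tp a e y) e = 0.
Proof.
move=> y0; have h1 := jordan e y e a e; have h2 := jordan e a e y e.
rewrite y0 !tpE (tpC y e a) in h1; rewrite y0 !tpE (tpC (tp e a e) y e) in h2.
have h : tp e y (tp e a e) = 0 by apply: (lincomb2 3^-1 (- 3^-1) h1 h2); vec_field.
by split=> //; apply: (lincomb2 1 (-1) h1 h); vec_field.
Qed.

Lemma peirce1_selfadj_mul y a : peirce1 y -> selfadj tp e a ->
  tp e y a = 0 /\ tp e (tp a e y) e = 0.
Proof. by move=> [_ y0] sa; have := annihilated_mul a y0; rewrite sa. Qed.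

Lemma peirce1_skewadj_mul y k : peirce1 y -> skewadj k ->
  tp e y k = 0 /\ tp e (tp k e y) e = 0.
Proof.
move=> [_ y0] sk; have := annihilated_mul k y0; rewrite sk !tpE => -[h ->].
by split=> //; apply: oppr_inj; rewrite h oppr0.
Qed.

(** B = {y,y,e} is fixed by L(e,e), and L(y,y) applied to {e,e,e} then gives B = 2B - {e,B,e}. *)
Lemma peirce1_box_selfadj y : peirce1 y -> selfadj tp e (tp y y e).
Proof.
move=> [Dy Qy]; set B := tp y y e.
have DB : tp e e B = B by rewrite /B jordan ee Dy !tpE; vec_field.
have := jordan y y e e e; rewrite ee -/B (tpC B) DB => h.
by apply: (lincomb1 1 h); vec_field.
Qed.

(* The cube of e + tb is e + tb + O(t^2), so the excess u of |e + tb| over 1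
   satisfies 3u <= u + O(t^2). *)
Lemma dnorm_le0_peirce b : 2 *: tp e e b + tp e b e = b -> dnorm_le0 e b.
Proof.
move=> hb; pose c := 2 *: tp b b e + tp b e b; pose d := tp b b b.
apply: (@dnorm_le0_quadratic _ _ _ _ (nrm c + nrm d)) => t t0 t1.
have c0 : 0 <= nrm c + nrm d by rewrite addr_ge0 ?nrm_ge0.
have [h|h] := leP (nrm (e + t%:C *: b)) 1.
  by apply: le_trans h _; rewrite lerDl mulr_ge0 // sqr_ge0.
have := tp_cube_norm JB (e + t%:C *: b).
have -> : tp (e + t%:C *: b) (e + t%:C *: b) (e + t%:C *: b) =
    e + t%:C *: b + ((t ^+ 2)%:C *: c + (t ^+ 3)%:C *: d).
  rewrite !tpE ee -[in RHS]hb /c /d (tpC b e e) (tpC b b e); vec_field.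
move=> cube; have := nrmD (e + t%:C *: b) ((t ^+ 2)%:C *: c + (t ^+ 3)%:C *: d).
rewrite cube; have := nrmD ((t ^+ 2)%:C *: c) ((t ^+ 3)%:C *: d).
rewrite !nrmZge0 ?exprn_ge0 ?(ltW t0) //.
have : t ^+ 3 * nrm d <= t ^+ 2 * nrm d.
  by rewrite ler_wpM2r ?nrm_ge0 // ler_wiXn2l ?(ltW t0).
move: (nrm (_ + _)) (nrm (e + _)) h => v u u1 h1 h2 h3.
(* The product is u^3 - 3u + 2, so u^3 exceeds 1 by at least 3(u - 1). *)
have : 0 <= (u - 1) ^+ 2 * (u + 2) by rewrite mulr_ge0 ?sqr_ge0 //; lra.
by rewrite !exprS !expr0 in h1 h2 h3 *; nra.
Qed.

(** The generator T = L(k,e) - L(e,k) has Te = 2k and T(Te) = 4{k,e,k}. *)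
Lemma dnorm_le0_skewadj k : skewadj k -> dnorm_le0 e (tp k e k).
Proof.
move=> sk; have := skew_sqr_dnorm_le0 (skew_derivation JB k e) nrm_tripotent_le1.
rewrite (tpC k e e) (skewadj_D sk) sk !tpE !(skewadj_comm _ sk).
set X := (X in dnorm_le0 e X); have -> : X = 4%:C *: tp k e k by rewrite /X; vec_field.
move/(@dnorm_le0Z _ _ _ _ 4^-1); rewrite scalerA -rmorphM mulVf ?pnatr_eq0 //.
by rewrite rmorph1 scale1r; apply; lra.
Qed.

End PeirceParts.

(** * Complete tripotents are extreme *)

Section CompleteTripotent.
Context {R : realType} {E : normedModType R[i]} (tp : E -> E -> E -> E).
Hypothesis JB : is_JBstar_triple tp.
Variables (W : set E) (e : E).
Hypothesis Wsub : real_subspace W.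
Hypothesis Wtp : forall x y z, W x -> W y -> W z -> W (tp x y z).
Hypothesis ce : complete_tripotent tp W e.
Implicit Types (a b c x y z u v w h k : E) (r s t : R).

Let tpE := (tpE JB).
Let tpC := (tpC JB).
Let jordan := (jordan JB).
Let We : W e. Proof. by case: ce => [[]]. Qed.
Let ee : tp e e e = e. Proof. by case: ce => [[]]. Qed.
Let complete_e x : W x -> tp e e x = 0 -> x = 0. Proof. by case: ce => _; exact. Qed.

Lemma peirce_decomposition x : W x -> exists k y,
  [/\ W k, W y, x = hpart tp e x + k + y, skewadj tp e k & peirce1 tp e y].
Proof.
move=> Wx.
have WQ z : W z -> W (tp e z e) by move=> Wz; exact: Wtp.
have QQ z := peirce_QQ JB ee z.
have DQ z := peirce_DQ JB ee z.
have QQQ z := peirce_QQQ JB ee z.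
exists ((2^-1)%:C *: (tp e (tp e x e) e - tp e x e)), (x - tp e (tp e x e) e).
(* The difference of the two sides is the Peirce-0 component of [x], which completeness kills. *)
have x0 : x = 2 *: tp e e x - tp e (tp e x e) e.
  apply/eqP; rewrite -subr_eq0; apply/eqP/complete_e.
    rewrite -(rmorph_nat (real_complex R)); apply: (rsubB Wsub Wx); apply: (rsubB Wsub).
      by apply: (rsubZ Wsub); exact: Wtp.
    by do 2 apply: (WQ).
  have := QQ x; rewrite !tpE !DQ => ->.
  by vec_field.
split.
- by apply: (rsubZ Wsub); apply: (rsubB Wsub); do ?apply: (WQ).
- by apply: (rsubB Wsub) => //; do 2 apply: (WQ).
- by rewrite /hpart; vec_field.
- by rewrite /skewadj !tpE QQQ; vec_field.
- split; first by rewrite !tpE !DQ; apply: (lincomb1 (- 2^-1) x0); vec_field.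
  by rewrite !tpE QQQ subrr.
Qed.

(** L(e,e) acts on {y,e,y} by 1/2 - 1 + 1/2 = 0, so completeness applies. *)
Lemma peirce1_sqr y : W y -> peirce1 tp e y -> tp y e y = 0.
Proof.
move=> Wy [Dy Qy]; apply: complete_e; first exact: Wtp.
by rewrite jordan ee Dy !tpE; vec_field.
Qed.

(** On the parts outside A the operator 2L(e,e) + Q(e) is the identity, so [dnorm_le0_peirce] allows
    them to be subtracted. *)
Lemma dnorm_le0_hpart x : W x -> dnorm_le0 e x -> dnorm_le0 e (hpart tp e x).
Proof.
move=> Wx dx; have [k [y [Wk Wy xE sk [Dy Qy]]]] := peirce_decomposition Wx.
have -> : hpart tp e x = x + - (k + y) by rewrite {2}xE; vec_field.
apply: dnorm_le0D => //; apply: (dnorm_le0_peirce JB ee).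
by rewrite !tpE (skewadj_D JB ee sk) sk Dy Qy; vec_field.
Qed.

Lemma dnorm_le0_peirce1 y : W y -> peirce1 tp e y -> dnorm_le0 e (- tp y y e).
Proof.
move=> Wy hy; have := skew_sqr_dnorm_le0 (skew_derivation JB y e) (nrm_tripotent_le1 JB ee).
have y2 := peirce1_sqr Wy hy; case: hy => Dy Qy.
rewrite (tpC y e e) Dy Qy subr0 !tpE y2 (tpC e y y).
set X := (X in dnorm_le0 e X); have -> : X = (2^-1)%:C *: - tp y y e by rewrite /X; vec_field.
move/(@dnorm_le0Z _ _ _ _ 2); rewrite scalerA -rmorphM mulfV ?pnatr_eq0 //.
by rewrite rmorph1 scale1r; apply; lra.
Qed.

(** {k,e,k} and - {y,y,e} already have derivative at most 0. The hypothesis on the opposite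
    combination makes each of them flat both ways, hence zero by [flat_selfadj_eq0]; the cubes of
    [k] and [y] then vanish. *)
Lemma peirce_parts_eq0 k y r s : W y -> skewadj tp e k -> peirce1 tp e y -> 0 < r -> 0 < s ->
  dnorm_le0 e (r%:C *: - tp k e k + s%:C *: tp y y e) -> k = 0 /\ y = 0.
Proof.
move=> Wy sk hy r0 s0 d.
have dk := (dnorm_le0_skewadj JB ee sk); have dy := dnorm_le0_peirce1 Wy hy.
have k2 : tp k e k = 0.
  apply: (flat_selfadj_eq0 JB ee (skewadj_sqr JB ee sk) dk).
  have d' : dnorm_le0 e (r%:C *: - tp k e k).
    have := dnorm_le0D d (dnorm_le0Z s0 dy); congr (dnorm_le0 e _); vec_field.
  have ri : 0 < r^-1 by rewrite invr_gt0.
  by have := dnorm_le0Z ri d'; rewrite scalerA -rmorphM mulVf ?gt_eqF // rmorph1 scale1r.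
have y2 : tp y y e = 0.
  apply: (flat_selfadj_eq0 JB ee (peirce1_box_selfadj JB ee hy) _ dy).
  have si : 0 < s^-1 by rewrite invr_gt0.
  have := dnorm_le0Z si d; rewrite k2 oppr0 scaler0 add0r scalerA -rmorphM.
  by rewrite mulVf ?gt_eqF // rmorph1 scale1r.
have cube0 z : tp z z z = 0 -> z = 0.
  move=> z0; apply/nrm_eq0/eqP; have := tp_cube_norm JB z.
  by rewrite z0 nrm0 => /esym/eqP; rewrite expf_eq0.
split; apply: cube0.
  have ekk : tp e k k = 0 by rewrite (skewadj_comm JB ee) // k2 oppr0.
  have := jordan k e e k k; rewrite ekk k2 (tpC k e e) (skewadj_D JB ee) // !tpE.
  by rewrite subr0 addr0.
have eyy : tp e y y = 0 by rewrite tpC.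
have := jordan y e e y y; rewrite eyy (peirce1_sqr Wy hy) (tpC y e e) hy.1 !tpE.
rewrite subr0 addr0 => /esym/eqP; rewrite scaler_eq0 fmorph_eq0 invr_eq0 pnatr_eq0 /=.
by move/eqP.
Qed.

Lemma complete_tripotent_extreme x : W x -> nrm (e + x) <= 1 -> nrm (e - x) <= 1 ->
  x = 0.
Proof.
move=> Wx hp hm.
have seg t z : nrm (e + z) <= 1 -> 0 < t -> t <= 1 -> nrm (e + t%:C *: z) <= 1.
  move=> h t0 t1; have -> : e + t%:C *: z = (1 - t)%:C *: e + t%:C *: (e + z).
    by vec_field.
  apply: le_trans (nrmD _ _) _; rewrite !nrmZge0 ?subr_ge0 ?(ltW t0) //.
  have := ler_wpM2l (ltW t0) h; have t1' : 0 <= 1 - t by rewrite subr_ge0.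
  by have := ler_wpM2l t1' (nrm_tripotent_le1 JB ee); lra.
have dseg z : nrm (e + z) <= 1 -> dnorm_le0 e z.
  move=> h; apply: (@dnorm_le0_quadratic _ _ _ _ 0) => t t0 t1.
  by rewrite mul0r addr0; exact: seg.
have [k [y [Wk Wy xE sk hy]]] := peirce_decomposition Wx.
have h0 : hpart tp e x = 0.
  apply: (flat_selfadj_eq0 JB ee (selfadj_hpart JB ee x)); first by apply: dnorm_le0_hpart => //; exact: dseg.
  by rewrite -(hpartN JB); apply: dnorm_le0_hpart; [exact: (rsubN Wsub)|exact: dseg].
rewrite h0 add0r in xE.
have [ky1 ky2] := peirce1_skewadj_mul JB hy sk.
(* This is the s^2 coefficient of the average of the cubes of e + sx and e - sx, which stays in the
   unit ball. *)
have wE : 2 *: tp x x e + tp x e x = 1%:C *: - tp k e k + 2%:C *: tp y y e.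
  rewrite xE !tpE (tpC k k e) (tpC k y e) (tpC y k e) !(skewadj_comm JB ee _ sk) ky1.
  by rewrite (peirce1_sqr Wy hy) (tpC y e k); vec_field.
have [k0 y0] : k = 0 /\ y = 0; last by rewrite xE k0 y0 addr0.
apply: (@peirce_parts_eq0 _ _ 1 2) => //.
rewrite -wE; apply: (@dnorm_le0_cubic _ _ _ _ 0) => s s0 s1; rewrite mul0r addr0.
have cube z : nrm z <= 1 -> nrm (tp z z z) <= 1.
  by move=> z1; rewrite (tp_cube_norm JB) exprn_ile1 // nrm_ge0.
have -> : e + (s ^+ 2)%:C *: (2 *: tp x x e + tp x e x) =
    (2^-1)%:C *: tp (e + s%:C *: x) (e + s%:C *: x) (e + s%:C *: x) +
    (2^-1)%:C *: tp (e + s%:C *: (- x)) (e + s%:C *: (- x)) (e + s%:C *: (- x)).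
  by rewrite !tpE ee (tpC e x x); vec_field.
apply: le_trans (nrmD _ _) _; rewrite !nrmZge0 ?invr_ge0 //.
have := cube _ (seg _ _ hp s0 s1); have := cube _ (seg _ _ hm s0 s1).
by move: (nrm _) (nrm _) => u v; lra.
Qed.

End CompleteTripotent.

(** * M-summands *)

Section MSummands.
Context {R : realType} {E : normedModType R[i]}.
Implicit Types (W M N : set E) (a b c d m n x y z u v w : E) (r s t : R).

Lemma linf_decompositionC W M N : linf_decomposition W M N -> linf_decomposition W N M.
Proof.
move=> [[sM sN] [MW NW] dec uniq nrmMN]; split=> //.
- by move=> w /dec[m [n [Mm Nn ->]]]; exists n, m; rewrite addrC.
- by move=> n m Nn Mm; rewrite addrC => /(uniq _ _ Mm Nn)[].
- by move=> n m Nn Mm; rewrite addrC nrmMN // !nrmE /Num.max !ltcR; case: ltgtP => // ->.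
Qed.

Variables (W M N : set E).
Hypothesis WMN : linf_decomposition W M N.

Let sM : real_subspace M. Proof. by case: WMN => [[]]. Qed.
Let sN : real_subspace N. Proof. by case: WMN => [[]]. Qed.

Lemma linf_nrm m n : M m -> N n -> nrm (m + n) = Num.max (nrm m) (nrm n).
Proof.
case: WMN => _ _ _ _ h Mm Nn; apply: (@complexI R); rewrite -nrmE h // !nrmE.
by rewrite /Num.max ltcR; case: ltP.
Qed.

Lemma linf_le m n r : M m -> N n -> (nrm (m + n) <= r) = (nrm m <= r) && (nrm n <= r).
Proof. by move=> Mm Nn; rewrite linf_nrm // ge_max. Qed.

Lemma dnorm_le0_linf m n u v : M m -> N n -> M u -> N v ->
  dnorm_le0 m u -> dnorm_le0 n v -> dnorm_le0 (m + n) (u + v).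
Proof.
move=> Mm Nn Mu Nv hu hv eps eps0.
have [d1 d10 H1] := hu _ eps0; have [d2 d20 H2] := hv _ eps0.
exists (Num.min d1 d2) => [|t t0]; first by rewrite lt_min d10.
rewrite lt_min => /andP[t1 t2]; rewrite scalerDr addrACA.
by rewrite linf_le ?H1 ?H2 //; [apply: (rsubD sM) => //; exact: (rsubZ sM)
  |apply: (rsubD sN) => //; exact: (rsubZ sN)].
Qed.

Lemma dnorm_le0_linf_l m n u v : M m -> N n -> M u -> N v ->
  dnorm_le0 (m + n) (u + v) -> dnorm_le0 m u.
Proof.
move=> Mm Nn Mu Nv h eps eps0; have [d d0 H] := h _ eps0; exists d => // t t0 td.
have Mx : M (m + t%:C *: u) by apply: (rsubD sM) => //; exact: (rsubZ sM).
have Nx : N (n + t%:C *: v) by apply: (rsubD sN) => //; exact: (rsubZ sN).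
by have := H _ t0 td; rewrite scalerDr addrACA (linf_le _ Mx Nx) => /andP[].
Qed.

(* If T m had a component b in N, then moving m + lambda b along T (with
   lambda b of the same norm as m) would increase the norm of the N-component
   at the rate nrm b, although T is skew. *)
Lemma skew_stable (T : E -> E) m : skew_op T -> (forall x, W x -> W (T x)) ->
  M m -> M (T m).
Proof.
move=> sT TW Mm; have [_ [MW NW] dec _ _] := WMN; have [Tl Ts] := sT.
have [a [b [Ma Nb Tm]]] := dec _ (TW _ (MW _ Mm)).
suff b0 : b = 0 by rewrite Tm b0 addr0.
have [c [d [Mc Nd Tb]]] := dec _ (TW _ (NW _ Nb)).
apply/nrm_eq0/eqP; rewrite eq_le nrm_ge0 andbT leNgt; apply/negP => b0.
pose l := nrm m / nrm b; have l0 : 0 <= l by rewrite divr_ge0 ?nrm_ge0.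
pose x := m + l%:C *: b.
have lb : l * nrm b = nrm m by rewrite /l divfK // gt_eqF.
have nx : nrm x = nrm m.
  by rewrite /x linf_nrm ?nrmZge0 ?lb ?maxxx //; exact: (rsubZ sN).
pose C := nrm (T (T x)) + nrm d.
have C0 : 0 <= C by rewrite addr_ge0 ?nrm_ge0.
have key t : 0 < t -> t * nrm c < nrm b -> nrm b <= t * C.
  move=> t0 tc; have lt0 : 0 < l + t by rewrite ltr_wpDl.
  have h1 : nrm ((l + t)%:C *: (b + t%:C *: d) - (t ^+ 2)%:C *: d) <=
      nrm m + t ^+ 2 * nrm (T (T x)).
    have := skew_first_order t x sT; rewrite nx.
    have -> : x + t%:C *: T x = (m + t%:C *: a + (t * l)%:C *: c) +
        ((l + t)%:C *: (b + t%:C *: d) - (t ^+ 2)%:C *: d).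
      by rewrite /x (clinD _ _ Tl) (clinZ _ _ Tl) Tm Tb; vec_field.
    rewrite (linf_le _ (_ : M _) (_ : N _)); first by case/andP.
      by do ![apply: (rsubD sM)|apply: (rsubZ sM)|done].
    by do ![apply: (rsubB sN)|apply: (rsubD sN)|apply: (rsubZ sN)|done].
  (* Skewness at [b] bounds [nrm b] by a maximum whose M-term t * nrm c is too small. *)
  have h2 : nrm b <= nrm (b + t%:C *: d).
    have Mtc : M (t%:C *: c) by exact: (rsubZ sM).
    have Nbd : N (b + t%:C *: d) by apply: (rsubD sN) => //; exact: (rsubZ sN).
    have := Ts t b; rewrite Tb scalerDr addrCA (linf_nrm Mtc Nbd).
    by rewrite le_max nrmZge0 ?(ltW t0) // leNgt tc.
  have h3 := nrmD ((l + t)%:C *: (b + t%:C *: d) - (t ^+ 2)%:C *: d) ((t ^+ 2)%:C *: d).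
  rewrite subrK !nrmZge0 ?sqr_ge0 ?(ltW lt0) // in h3.
  have h4 := ler_wpM2l (ltW lt0) h2.
  rewrite -(@ler_pM2l _ t) // /C.
  have : (l + t) * nrm b <= nrm m + t ^+ 2 * nrm (T (T x)) + t ^+ 2 * nrm d.
    by apply: le_trans h4 (le_trans h3 _); rewrite lerD2r.
  by rewrite mulrDl lb; lra.
pose t := nrm b / (2 * (1 + nrm c + C)).
have den : 0 < 2 * (1 + nrm c + C) by have := nrm_ge0 c; lra.
have t0 : 0 < t by rewrite divr_gt0.
have tden : t * (2 * (1 + nrm c + C)) = nrm b by rewrite /t divfK // gt_eqF.
have tc0 := mulr_ge0 (ltW t0) (nrm_ge0 c); have tC0 := mulr_ge0 (ltW t0) C0.
by have := key t t0 ltac:(lra); lra.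
Qed.

End MSummands.

(** * The components of a complete tripotent *)

Section SummandsOfCompleteTripotent.
Context {R : realType} {E : normedModType R[i]} (tp : E -> E -> E -> E).
Hypothesis JB : is_JBstar_triple tp.
Variables (W : set E) (e : E).
Hypothesis Wsub : real_subspace W.
Hypothesis Wtp : forall x y z, W x -> W y -> W z -> W (tp x y z).
Hypothesis ce : complete_tripotent tp W e.
Implicit Types (M N : set E) (a b c h k m n x y z u v w : E) (r s t : R).

Let tpE := (tpE JB).
Let tpC := (tpC JB).
Let We : W e. Proof. by case: ce => [[]]. Qed.
Let ee : tp e e e = e. Proof. by case: ce => [[]]. Qed.
Let e1 : nrm e <= 1. Proof. exact: (nrm_tripotent_le1 JB ee). Qed.

(** All mixed products vanish or have no component in A; what remains is the combination treated by
    [peirce_parts_eq0]. *)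
Lemma hpart_derivation h k y : W y -> selfadj tp e h -> skewadj tp e k -> peirce1 tp e y ->
  hpart tp e (tp e (k + y) (h + k + y) - tp (k + y) e (h + k + y)) =
  2%:C *: - tp k e k + 1%:C *: tp y y e.
Proof.
move=> Wy sh sk hy.
have [yh1 yh2] := peirce1_selfadj_mul JB hy sh; have [yk1 yk2] := peirce1_skewadj_mul JB hy sk.
have y2 := peirce1_sqr JB Wtp ce Wy hy.
rewrite tpC in yh1; rewrite tpC in yk1.
rewrite !tpE !(skewadj_comm JB ee _ sk) (tpC e y h) yh1 (tpC e y k) yk1 (tpC e y y) y2.
rewrite (tpC y e h) (tpC y e k).
have sB := peirce1_box_selfadj JB ee hy; have sS := skewadj_sqr JB ee sk.
have sG := skewadj_mul JB ee sk sh.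
rewrite /hpart !tpE sG yh2 yk2 sS sB !tpE sG sS sB; vec_field.
Qed.

Lemma summand_selfadj M N m n : linf_decomposition W M N -> M m -> N n -> e = m + n ->
  selfadj tp e m.
Proof.
move=> WMN Mm Nn eE; have [_ [MW NW] _ _ _] := WMN.
have [k [y [Wk Wy mE sk hy]]] := peirce_decomposition JB Wsub Wtp ce (MW _ Mm).
have sh := selfadj_hpart JB ee m.
suff [k0 y0] : k = 0 /\ y = 0 by rewrite mE k0 y0 !addr0.
have Wky : W (k + y) by exact: (rsubD Wsub).
have sT := skew_derivation JB e (k + y).
have TW x : W x -> W (tp e (k + y) x - tp (k + y) e x).
  by move=> Wx; apply: (rsubB Wsub); exact: Wtp.
have MT := skew_stable WMN sT TW Mm; rewrite /= in MT.
apply: (@peirce_parts_eq0 _ _ _ JB W e Wtp ce k y 2 1) => //.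
rewrite -(hpart_derivation Wy sh sk hy) -mE.
apply: (dnorm_le0_hpart JB Wsub Wtp ce); first by apply: TW; exact: MW.
have := e1; rewrite [in nrm e]eE (linf_le WMN) // => /andP[m1 n1].
have dm := skew_dnorm_le0 sT m1.
have dn : dnorm_le0 n 0.
  apply: (@dnorm_le0_quadratic _ _ _ _ 0) => t _ _; rewrite scaler0 addr0 mul0r addr0 //.
have N0 : N 0 by case: WMN => [[_ [? _ _]]].
by have := dnorm_le0_linf WMN Mm Nn MT N0 dm dn; rewrite addr0 -eE.
Qed.

(** The direction [- u] comes from T(Te) = - n^2 for T = iL(n,e). For [u], the M-component of (e -
    sn)^3 is m + 3s^2 u + O(s^3): the term linear in s lies in N. *)
Lemma summand_square_flat M N m n u v : linf_decomposition W M N -> M m -> N n ->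
  e = m + n -> selfadj tp e n -> M u -> N v -> tp n e n = u + v ->
  dnorm_le0 m u /\ dnorm_le0 m (- u).
Proof.
move=> WMN Mm Nn eE sn Mu Nv n2; have [[sM sN] [MW NW] dec _ _] := WMN.
have := e1; rewrite [in nrm e]eE (linf_le WMN) // => /andP[m1 n1].
split; last first.
  have := skew_sqr_dnorm_le0 (skew_selfadj JB ee sn) e1.
  rewrite (selfadj_D' JB ee sn) !tpE n2 scalerA mulii scaleN1r opprD {1}eE.
  apply: (dnorm_le0_linf_l WMN) => //; [exact: (rsubN sM)|exact: (rsubN sN)].
have [u3 [v3 [Mu3 Nv3 n3]]] := dec _ (Wtp (NW _ Nn) (NW _ Nn) (NW _ Nn)).
suff d3 : dnorm_le0 m (3%:C *: u).
  have := dnorm_le0Z (_ : 0 < 3^-1) d3; rewrite scalerA -rmorphM mulVf ?pnatr_eq0 //.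
  by rewrite rmorph1 scale1r; apply; rewrite invr_gt0.
apply: (@dnorm_le0_cubic _ _ _ _ (nrm u3)) => s s0 s1.
have le1 : nrm (e - s%:C *: n) <= 1.
  have -> : e - s%:C *: n = m + (1 - s)%:C *: n by rewrite eE; vec_field.
  rewrite (linf_le WMN) ?m1 //=; last exact: (rsubZ sN).
  rewrite nrmZge0 ?subr_ge0 // mulr_ile1 ?subr_ge0 ?nrm_ge0 //; lra.
have cube : tp (e - s%:C *: n) (e - s%:C *: n) (e - s%:C *: n) =
    (m + (s ^+ 2)%:C *: (3%:C *: u) - (s ^+ 3)%:C *: u3) +
    ((1 - 3 * s)%:C *: n + (s ^+ 2)%:C *: (3%:C *: v) - (s ^+ 3)%:C *: v3).
  have nne : tp n n e = u + v.
    by have := jpow_box JB ee sn 1 1 e; rewrite /jpow /= (selfadj_D' JB ee sn) n2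
      (selfadj_D' JB ee) // -n2; exact: (selfadj_mul JB ee).
  rewrite !tpE ee (selfadj_D' JB ee sn) (selfadj_D JB ee sn) sn (tpC e n n) nne n2 n3.
  by rewrite {1}eE; vec_field.
have : nrm (tp (e - s%:C *: n) (e - s%:C *: n) (e - s%:C *: n)) <= 1.
  by rewrite (tp_cube_norm JB) exprn_ile1 // nrm_ge0.
rewrite cube (linf_le WMN); last 2 first.
- by do ![apply: (rsubB sM)|apply: (rsubD sM)|apply: (rsubZ sM)|done].
- by do ![apply: (rsubB sN)|apply: (rsubD sN)|apply: (rsubZ sN)|done].
move=> /andP[h _]; have := nrmD (m + (s ^+ 2)%:C *: (3%:C *: u) - (s ^+ 3)%:C *: u3)
  ((s ^+ 3)%:C *: u3).
rewrite subrK nrmZge0 ?exprn_ge0 ?(ltW s0) // => h'.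
by apply: le_trans h' _; rewrite mulrC lerD2r.
Qed.

(** Write n^2 = u + v. Then m^2 = (e - n)^2 has N-component v - n, so flatness of [u] at [m] and of
    v - n at [n] makes n^2 - n flat at [e]. *)
Lemma summand_idempotent M N m n : linf_decomposition W M N -> M m -> N n ->
  e = m + n -> tp n e n = n.
Proof.
move=> WMN Mm Nn eE; have [[sM sN] [MW NW] dec _ _] := WMN.
have WNM := linf_decompositionC WMN.
have eE' : e = n + m by rewrite addrC.
have sm := summand_selfadj WMN Mm Nn eE; have sn := summand_selfadj WNM Nn Mm eE'.
have [u [v [Mu Nv n2]]] := dec _ (Wtp (NW _ Nn) We (NW _ Nn)).
have [hu1 hu2] := summand_square_flat WMN Mm Nn eE sn Mu Nv n2.
have Mmu : M (m + u) by exact: (rsubD sM).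
have Nvn : N (v - n) by exact: (rsubB sN).
have m2 : tp m e m = v - n + (m + u).
  have -> : m = e - n by rewrite eE addrK.
  by rewrite !tpE ee n2 (selfadj_D' JB ee sn) (selfadj_D JB ee sn); vec_field.
have [hv1 hv2] := summand_square_flat WNM Nn Mm eE' sm Nvn Mmu m2.
apply/eqP; rewrite -subr_eq0 n2 -addrA; apply/eqP.
apply: (flat_selfadj_eq0 JB ee).
- have := selfadj_lin JB 1 (-1) (selfadj_mul JB ee sn sn) sn.
  by rewrite rmorphN !rmorph1 scale1r scaleN1r n2 -addrA.
- by rewrite {1}eE; apply: (dnorm_le0_linf WMN).
- rewrite opprD {1}eE; apply: (dnorm_le0_linf WMN) => //; [exact: (rsubN sM)|exact: (rsubN sN)].
Qed.

Lemma idempotent_box n y : selfadj tp e n -> tp n e n = n -> tp n n y = tp n e y.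
Proof.
move=> sn n2; have := jpow_box JB ee sn 1 1 y.
by rewrite /jpow /= (selfadj_D' JB ee sn) n2.
Qed.

(** If [m] were 0, adding or subtracting a unit vector of M would keep [e] in the ball, against
    extremality. *)
Lemma summand_neq0 M N m n : linf_decomposition W M N -> M m -> N n -> e = m + n ->
  (exists m', M m' /\ m' <> 0) -> m <> 0.
Proof.
move=> WMN Mm Nn eE [m' [Mm' m'0]] m0; have [[sM sN] [MW NW] _ _ _] := WMN.
have nm' : nrm m' != 0 by apply: contra_notN m'0 => /eqP/nrm_eq0.
pose x := (nrm m')^-1%:C *: m'.
have Mx : M x by exact: (rsubZ sM).
have x1 : nrm x = 1 by rewrite nrmZge0 ?invr_ge0 ?nrm_ge0 // mulVf.
have en : e = n by rewrite eE m0 add0r.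
have x0 : x = 0.
  apply: (complete_tripotent_extreme JB Wsub Wtp ce); first exact: MW.
    by rewrite addrC en (linf_le WMN) // x1 -en e1 lexx.
  by rewrite addrC en (linf_le WMN _ (rsubN sM Mx) Nn) nrmN x1 -en e1 lexx.
by move: x1; rewrite x0 nrm0 => /esym/eqP; rewrite oner_eq0.
Qed.

Lemma summand_extreme M N m n : linf_decomposition W M N -> M m -> N n -> e = m + n ->
  extreme_point_ball M m.
Proof.
move=> WMN Mm Nn eE; have [[sM sN] [MW NW] _ _ _] := WMN.
have := e1; rewrite [in nrm e]eE (linf_le WMN) // => /andP[m1 n1].
split=> //; first by rewrite -nrm_le1.
move=> y z t My Mz; rewrite -!nrm_le1 => y1 z1 /andP[t0 t1] mE.
(* Both t + c and t - c stay in [0,1], so [e] is the midpoint of a segment in the ball along y -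
   z. *)
pose c := Num.min t (1 - t).
have c0 : 0 < c by rewrite lt_min t0 subr_gt0.
have [ct ct1] : c <= t /\ c <= 1 - t by split; rewrite ge_min lexx ?orbT.
have seg r : 0 <= r -> 0 <= 1 - r -> nrm (r%:C *: y + (1 - r)%:C *: z + n) <= 1.
  move=> r0 r1; rewrite (linf_le WMN) ?n1 ?andbT //; last first.
    by apply: (rsubD sM); exact: (rsubZ sM).
  apply: le_trans (nrmD _ _) _; rewrite !nrmZge0 //.
  by have := ler_wpM2l r0 y1; have := ler_wpM2l r1 z1; lra.
have x0 : c%:C *: (y - z) = 0.
  apply: (complete_tripotent_extreme JB Wsub Wtp ce).
  - by apply: MW; apply: (rsubZ sM); exact: (rsubB sM).
  - have -> : e + c%:C *: (y - z) = (t + c)%:C *: y + (1 - (t + c))%:C *: z + n.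
      by rewrite eE mE; vec_field.
    by apply: seg; lra.
  - have -> : e - c%:C *: (y - z) = (t - c)%:C *: y + (1 - (t - c))%:C *: z + n.
      by rewrite eE mE; vec_field.
    by apply: seg; lra.
move/eqP: x0; rewrite scaler_eq0 fmorph_eq0 gt_eqF //= subr_eq0 => /eqP //.
Qed.

End SummandsOfCompleteTripotent.

Theorem theorem3p5 (R : realType) (E : normedModType R[i])
    (tp : E -> E -> E -> E) (W M N : set E) (P : E -> E) :
  is_real_JBWstar_triple tp W ->
  linf_decomposition W M N ->
  (exists m, M m /\ m <> 0) ->
  (exists n, N n /\ n <> 0) ->
  (forall w, W w -> M (P w) /\ N (w - P w)) ->
  forall e : E, complete_tripotent tp W e ->
    [/\ tripotent tp W (P e) /\ tripotent tp W (e - P e),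
        P e <> 0 /\ e - P e <> 0,
        triple_orthogonal tp W (P e) (e - P e) &
        extreme_point_ball M (P e) /\ extreme_point_ball N (e - P e)].
Proof.
move=> [[JB Wsub _ Wtp] _] WMN M0 N0 hP e ce.
have [[We ee] _] := ce; have [Mm Nn] := hP _ We.
have WNM := linf_decompositionC WMN; have [_ [MW NW] _ _ _] := WMN.
move: (P e) Mm (e - P e) Nn (subrKC (P e) e) => m Mm n Nn /esym eE.
have eE' : e = n + m by rewrite addrC.
have sm := summand_selfadj JB Wsub Wtp ce WMN Mm Nn eE.
have sn := summand_selfadj JB Wsub Wtp ce WNM Nn Mm eE'.
have n2 := summand_idempotent JB Wsub Wtp ce WMN Mm Nn eE.
have m2 := summand_idempotent JB Wsub Wtp ce WNM Nn Mm eE'.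
split.
- split; split; try by [exact: MW|exact: NW].
    by rewrite (idempotent_box JB ce).
  by rewrite (idempotent_box JB ce).
- split; first exact: (summand_neq0 JB Wsub Wtp ce WMN Mm Nn eE).
  exact: (summand_neq0 JB Wsub Wtp ce WNM Nn Mm eE').
(* L(m,n) = L(m,e) - L(m,m), and these agree for an idempotent. *)
- move=> z Wz; have -> : n = e - m by rewrite eE addrAC subrr add0r.
  by rewrite (tpDm JB) (tpNm JB) (idempotent_box JB ce) // subrr.
- split; first exact: (summand_extreme JB Wsub Wtp ce WMN Mm Nn eE).
  exact: (summand_extreme JB Wsub Wtp ce WNM Nn Mm eE').
Qed.
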